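(* Let $n\ge 1$, $k\ge 1$ and $\omega\in A_n$. The Primed-Recording Edelman–Greene map $v\mapsto (P(v),Q(v))$ is a bijection from $RSIF_k(\omega)$ onto the set of pairs $(P,Q)$ where $P$ is an Edelman–Greene tableau for $\omega$ and $Q$ is a primed tableau (over the alphabet $\{1'<1<\dots<k'<k\}$) of the same shape as $P$. Moreover it preserves double weight: $(dw(v,1),dw(v,2))=(dw(Q,1),dw(Q,2))$.
   Context: Let $W$ be the group generated by $s_{-n},\dots,s_{-1},s_0,s_1,\dots,s_n$ subject to $(s_as_b)^{m_{ab}}=1$, where $m_{ab}=1$ if $|a|=|b|$; $m_{ab}=3$ if $a,b\ne 0$ and $\bigl||a|-|b|\bigr|=1$; $m_{ab}=4$ if one of $a,b$ is $0$ and $\bigl||a|-|b|\bigr|=1$; $m_{ab}=2$ if $\bigl||a|-|b|\bigr|>1$ (so $s_{-a}=s_a$ and $W$ is the hyperoctahedral group $C_{n+1}$). $A_n\subseteq W$ is the subgroup generated by $s_1,\dots,s_n$ (the symmetric group $S_{n+1}$). A reduced word for $\omega\in W$ is an expression for $\omega$ in the generators $s_{-n},\dots,s_n$ of minimal length. A reduced signed increasing factorization of $\omega$ into $k$ parts is a reduced word for $\omega$ together with a division of it into $k$ consecutive (possibly empty) blocks, each strictly increasing for the order $s_{-n}<\dots<s_{-1}<s_0<s_1<\dots<s_n$; $RSIF_k(\omega)$ denotes the set of these. Its double weight $(dw(v,1),dw(v,2))\in\mathbb Z_{\ge0}^k\times\mathbb Z_{\ge0}^k$ has $i$-th entries equal,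 respectively, to the number of generators with negative index and the number with nonnegative index in the $i$-th block. For $\omega\in A_n$, an Edelman–Greene tableau for $\omega$ is a filling of a Young diagram (English convention) with elements of $\{s_1,\dots,s_n\}$, rows and columns strictly increasing for $s_1<\dots<s_n$, whose reading word (rows read left to right, from the bottom row to the top row) is a reduced word for $\omega$. A primed tableau of shape $\lambda/\mu$ over $X'_k=\{1'<1<2'<2<\dots<k'<k\}$ is a filling of the skew diagram $\lambda/\mu$ with letters of $X'_k$ such that rows and columns weakly increase, each row contains at most one $i'$ and each column at most one $i$, for every $i$. Its double weight is $(X,Y)$ with $X(i)$ = number of entries $i'$ and $Y(i)$ = number of entries $i$. Primed-Recording Edelman–Greene map: for $v\in RSIF_k(\omega)$, let $|v|$ be the word obtained by forgetting the blocks and replacing each $s_{-i}$ by $s_i$. $P(v)$ is the Edelman–Greene insertion tableau of $|v|$ (Edelman–Greene 1987). $Q(v)$ has the same shape: if inserting the $r$-th letter of $|v|$ adds the box $(a,b)$ to the insertion tableau, the box $(a,b)$ of $Q(v)$ is filled with $l'$ if the $r$-th letter of $v$ has negative index and with $l$ otherwise, where $l$ is the index of the block of $v$ containing that letter. *)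

(* Defs.v *)
From HB Require Import structures.
From mathcomp Require Import all_boot all_order all_fingroup all_algebra.
Unset Printing Implicit Defensive.
Import Order.TTheory GRing.Theory Num.Theory.

(* Concrete faithful model: signed permutations of {1..n+1}, i.e. permutations
   of the 2(n+1) points (sign, position) : bool * 'I_(n+1).
   s_0 exchanges +1 and -1; s_a (a <> 0) swaps positions |a|-1 and |a|
   (0-indexed), preserving signs.  Thus s_{-a} = s_a. *)
Definition pt (n : nat) := (bool * 'I_n.+1)%type.

Definition gen (n : nat) (a : int) : {perm pt n} :=
  let j := absz a in
  if j == 0%N then tperm (false, ord0) (true, ord0)
  else (tperm (false, inord j.-1) (false, inord j)
        * tperm (true, inord j.-1) (true, inord j))%g.

Definition weval (n : nat) (w : seq int) : {perm pt n} :=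
  (\prod_(a <- w) gen n a)%g.

Definition in_gens (n : nat) (w : seq int) : bool :=
  all (fun a : int => (absz a <= n)%N) w.

Definition reduced_word (n : nat) (omega : {perm pt n}) (w : seq int) : Prop :=
  [/\ in_gens n w, weval n w = omega &
      forall w', in_gens n w' -> weval n w' = omega -> (size w <= size w')%N].

Definition A_sub (n : nat) : {set {perm pt n}} :=
  <<[set gen n (Posz i) | i : 'I_n.+1 & (0 < i)%N]>>%g.

Definition RSIF (n k : nat) (omega : {perm pt n}) (v : seq (seq int)) : Prop :=
  [/\ size v = k,
      all (sorted (fun a b : int => a < b)%R) v &
      reduced_word n omega (flatten v)].

Definition dw_fact1 (v : seq (seq int)) : seq nat :=
  [seq count (fun a : int => a < 0)%R B | B <- v].
Definition dw_fact2 (v : seq (seq int)) : seq nat :=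
  [seq count (fun a : int => 0 <= a)%R B | B <- v].

(* A tableau is the list of its rows (top row first, English convention). *)

Definition is_partition (sh : seq nat) : bool :=
  sorted geq sh && all (fun m => (0 < m)%N) sh.

Definition rows_rel {T} (R : rel T) (t : seq (seq T)) : bool :=
  all (sorted R) t.

Definition cols_rel {T} (x0 : T) (R : rel T) (t : seq (seq T)) : bool :=
  [forall i : 'I_(size t), forall j : 'I_(size (nth [::] t i.+1)),
     R (nth x0 (nth [::] t i) j) (nth x0 (nth [::] t i.+1) j)].

Definition reading_word (t : seq (seq nat)) : seq nat := flatten (rev t).

Definition EG_tableau (n : nat) (omega : {perm pt n}) (P : seq (seq nat)) : Prop :=
  [/\ is_partition (shape P),
      all (fun r => all (fun x => (1 <= x <= n)%N) r) P,
      rows_rel ltn P, cols_rel 0%N ltn P &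
      reduced_word n omega [seq Posz x | x <- reading_word P]].

(* Primed letters: (l, true) = l', (l, false) = l;  1' < 1 < 2' < 2 < ... *)
Definition plet := (nat * bool)%type.
Definition prank (x : plet) : nat := (x.1.*2 - x.2)%N.
Definition ple : rel plet := fun x y => (prank x <= prank y)%N.

Definition primed_tableau (k : nat) (Q : seq (seq plet)) : Prop :=
  [/\ is_partition (shape Q),
      all (fun r => all (fun x : plet => (1 <= x.1 <= k)%N) r) Q,
      (* rows weakly increase, and each row has at most one i' *)
      rows_rel (fun x y => ple x y && ((x == y) ==> ~~ x.2)) Q &
      (* columns weakly increase, and each column has at most one i *)
      cols_rel (0%N, false) (fun x y => ple x y && ((x == y) ==> x.2)) Q].

Definition dw_tab1 (k : nat) (Q : seq (seq plet)) : seq nat :=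
  [seq count (pred1 (i, true)) (flatten Q) | i <- iota 1 k].
Definition dw_tab2 (k : nat) (Q : seq (seq plet)) : seq nat :=
  [seq count (pred1 (i, false)) (flatten Q) | i <- iota 1 k].

Definition eg_insert_row (r : seq nat) (x : nat) : seq nat * option nat :=
  let i := find (fun y => (x < y)%N) r in
  if i == size r then (rcons r x, None)
  else let y := nth 0%N r i in
       if (y == x.+1) && (x \in r) then (r, Some y)
       else (set_nth 0%N r i x, Some y).

(* Insert x into a tableau: returns the new tableau and the index of the row
   in which the new box was created (the box is at the end of that row). *)
Fixpoint eg_insert (t : seq (seq nat)) (x : nat) : seq (seq nat) * nat :=
  match t with
  | [::] => ([:: [:: x]], 0%N)
  | r :: t' =>
      match eg_insert_row r x with
      | (r', None) => (r' :: t', 0%N)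
      | (r', Some y) => let (t'', m) := eg_insert t' y in (r' :: t'', m.+1)
      end
  end.

Definition eg_step (PQ : seq (seq nat) * seq (seq plet)) (xl : nat * plet)
  : seq (seq nat) * seq (seq plet) :=
  let (P', m) := eg_insert PQ.1 xl.1 in
  (P', set_nth [::] PQ.2 m (rcons (nth [::] PQ.2 m) xl.2)).

Definition abs_word (v : seq (seq int)) : seq nat := [seq absz a | a <- flatten v].

Definition labels (v : seq (seq int)) : seq plet :=
  flatten [seq [seq (i.+1, (a < 0)%R) | a <- nth [::] v i] | i <- iota 0 (size v)].

Definition EG_PQ (v : seq (seq int)) : seq (seq nat) * seq (seq plet) :=
  foldl eg_step ([::], [::]) (zip (abs_word v) (labels v)).
Definition EG_P v := (EG_PQ v).1.
Definition EG_Q v := (EG_PQ v).2.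

(* Main.v *)
(* Edelman-Greene insertion only performs commutations and braid moves on the
   reading word, so the insertion tableau of a reduced word is an Edelman-Greene
   tableau for the same permutation, and one insertion step can be undone from the
   position of the new box.  If a < b, inserting a and then b puts the second new box
   weakly above (hence strictly to the right of) the first; if b < a, strictly below.
   Hence, in a word whose letters with equal labels decrease for primed labels and
   increase for unprimed ones, the boxes with a given label form a vertical,
   respectively horizontal, strip.  The last box added is recovered from Q as the
   lowest, respectively rightmost, box carrying the largest label, and undoing the
   insertion of that box step by step gives the inverse map.  Finally, the letter 0
   never occurs in a reduced word of an element of A_n: deleting all zeros does not
   change the product. *)
Require Import Defs.
From mathcomp Require Import all_boot all_order all_fingroup all_algebra.
From mathcomp Require Import zify.
Import Order.TTheory GRing.Theory Num.Theory.

(** * Braid equivalence and row insertion *)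

(* The word-level relation is kept free of [n] and of letter bounds; it is sound for
   [gen n] only on letters in [1, n] (see [beqv_wevaln]). *)
Inductive beqv : seq nat -> seq nat -> Prop :=
| beqv_refl w : beqv w w
| beqv_sym w1 w2 : beqv w1 w2 -> beqv w2 w1
| beqv_trans w1 w2 w3 : beqv w1 w2 -> beqv w2 w3 -> beqv w1 w3
| beqv_ctx u v w1 w2 : beqv w1 w2 -> beqv (u ++ w1 ++ v) (u ++ w2 ++ v)
| beqv_comm a b : a.+1 < b -> beqv [:: a; b] [:: b; a]
| beqv_braid a : beqv [:: a; a.+1; a] [:: a.+1; a; a.+1].

Lemma beqv_catl u w1 w2 : beqv w1 w2 -> beqv (u ++ w1) (u ++ w2).
Proof. by move=> /(beqv_ctx u [::]); rewrite !cats0. Qed.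

Lemma beqv_catr v w1 w2 : beqv w1 w2 -> beqv (w1 ++ v) (w2 ++ v).
Proof. exact: (beqv_ctx [::]). Qed.

Lemma beqv_comm_seq x r :
  all (fun y => (x.+1 < y) || (y.+1 < x)) r -> beqv (rcons r x) (x :: r).
Proof.
elim: r => [|y r IH] /=; first by move=> _; exact: beqv_refl.
case/andP=> xy /IH H; apply: beqv_trans (beqv_catl [:: y] _ _ H) _.
apply: (beqv_catr r [:: y; x] [:: x; y]).
by case/orP: xy => h; [apply: beqv_sym|]; apply: beqv_comm.
Qed.

(** Word-level substitute for minimal length: it mentions neither [n] nor the group, passes to
    prefixes and suffixes, and follows from reducedness ([reduced_breduced]). *)
Definition breduced w := forall u x v, ~ beqv w (u ++ x :: x :: v).

Lemma breduced_eqv w1 w2 : beqv w1 w2 -> breduced w1 -> breduced w2.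
Proof. by move=> e R u x v /(beqv_trans _ _ _ e)/R. Qed.

Lemma breduced_catl u v : breduced (u ++ v) -> breduced u.
Proof.
move=> R u' x v' /(beqv_catr v) e; apply: (R u' x (v' ++ v)).
by move: e; rewrite -catA.
Qed.

Lemma breduced_catr u v : breduced (u ++ v) -> breduced v.
Proof.
move=> R u' x v' /(beqv_catl u) e; apply: (R (u ++ u') x v').
by move: e; rewrite catA.
Qed.

Lemma incr_nth_lt {r : seq nat} {i j} : sorted ltn r -> i < j -> j < size r ->
  nth 0 r i < nth 0 r j.
Proof.
move=> sr ij jr; apply: (sorted_ltn_nth ltn_trans 0 sr) => //.
by rewrite inE; apply: ltn_trans jr.
Qed.

(** If the entry after [x] were missing or larger than [x.+1], every later entry would commute with
    [x], and the final letter could move left until it meets the other [x]. *)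
Lemma breduced_rcons_notin r x i : sorted ltn r -> breduced (rcons r x) ->
  i < size r -> nth 0 r i = x -> i.+1 < size r /\ nth 0 r i.+1 = x.+1.
Proof.
move=> sr R ir rx.
suff: ~~ ((size r <= i.+1) || (x.+1 < nth 0 r i.+1)).
  have := @incr_nth_lt r i i.+1 sr; lia.
apply/negP => h; apply: (R (take i r) x (drop i.+1 r)).
rewrite -{1}(cat_take_drop i r) (drop_nth 0) // rx rcons_cat /= -cat1s.
rewrite -[in X in beqv _ X]cat1s; do 2! apply: beqv_catl.
apply: beqv_comm_seq; apply/(all_nthP 0) => j; rewrite size_drop => jr.
rewrite nth_drop; case/orP: h => h; first lia.
case: j jr => [|j] jr; first by rewrite addn0 h.
by have := @incr_nth_lt r i.+1 (i.+1 + j.+1) sr; lia.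
Qed.

(* The three outcomes of inserting [x] into an increasing row when no word equivalent to
   [rcons r x] has a repeated adjacent letter; bumping [x.+1] out of a row that contains
   [x] then leaves the row unchanged and amounts to a braid move. *)
Inductive row_ins x r : seq nat -> option nat -> Prop :=
| RowAppend : (forall j, j < size r -> nth 0 r j < x) ->
    row_ins x r (rcons r x) None
| RowBump i y : i < size r -> nth 0 r i = y -> x < y ->
    (forall j, j < i -> nth 0 r j < x) ->
    row_ins x r (set_nth 0 r i x) (Some y)
| RowBraid i : i.+1 < size r -> nth 0 r i = x -> nth 0 r i.+1 = x.+1 ->
    row_ins x r r (Some x.+1).

Lemma mem_nth_ex (r : seq nat) x : x \in r -> exists2 j, j < size r & nth 0 r j = x.
Proof. by case/(nthP 0) => j; exists j. Qed.

Lemma find_first (T : Type) (x0 : T) (a : pred T) s i : i <= size s ->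
  (i < size s -> a (nth x0 s i)) -> (forall j, j < i -> ~~ a (nth x0 s j)) ->
  find a s = i.
Proof.
move=> ir ai H; case: (ltngtP (find a s) i) => // h.
  have h' : has a s by rewrite has_find; apply: leq_trans ir.
  by have := H _ h; rewrite nth_find.
have := before_find x0 h; rewrite ai //.
exact: leq_trans h (find_size _ _).
Qed.

(** [find] selects the first entry above [x]. If [x] is already in the row, [breduced_rcons_notin]
    puts [x.+1] right after it, so [x.+1] is selected and the special rule applies. *)
Lemma eg_insert_rowP r x : sorted ltn r -> breduced (rcons r x) ->
  row_ins x r (eg_insert_row r x).1 (eg_insert_row r x).2.
Proof.
move=> sr R; rewrite /eg_insert_row; set i := find _ r.
have lei j : j < i -> j < size r -> nth 0 r j <= x.
  by move=> ji jr; rewrite leqNgt (before_find 0 ji).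
have ir : i <= size r by exact: find_size.
have xy : i < size r -> x < nth 0 r i.
  by rewrite -has_find => /(nth_find 0).
have B j := breduced_rcons_notin r x j sr R.
clearbody i; case: eqP => /= [e|ne].
  apply: RowAppend => j jr; rewrite ltn_neqAle lei ?e // andbT.
  apply/eqP => rj; have [j1 rj1] := B _ jr rj.
  by have := lei j.+1; lia.
have {ne} ir : i < size r by lia.
have {}xy := xy ir.
case: ifP => /= h.
  case/andP: h => /eqP yx /mem_nth_ex [j jr rj].
  have [j1 rj1] := B _ jr rj.
  by rewrite yx; apply: RowBraid j1 rj rj1.
apply: RowBump => // j ji; rewrite ltn_neqAle lei ?andbT //; last lia.
apply/eqP => rj; have jr : j < size r by lia.
have [j1 rj1] := B _ jr rj.
have ij : i = j.+1 by have := lei j.+1; lia.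
move: h; rewrite ij rj1 eqxx /= => /negP; apply.
by rewrite -rj mem_nth.
Qed.

Lemma row_insE x r r' o : sorted ltn r -> row_ins x r r' o ->
  eg_insert_row r x = (r', o).
Proof.
move=> sr [H|i y ir ri xy H|i ir ri ri1]; rewrite /eg_insert_row.
- suff -> : find (fun y => x < y) r = size r by rewrite eqxx.
  apply: hasNfind; apply/hasPn => y /mem_nth_ex [j jr <-].
  by rewrite /=; have := H _ jr; lia.
- have -> : find (fun y => x < y) r = i.
    by apply: (find_first _ 0) => [|_|j /H]; rewrite ?ri; lia.
  rewrite ltn_eqF // ri; case: ifP => // /andP [/eqP _ /mem_nth_ex [j jr rj]].
  case: (ltngtP j i) => ij; first by have := H _ ij; lia.
    by have := incr_nth_lt sr ij jr; lia.
  by move: rj; rewrite ij; lia.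
- have -> : find (fun y => x < y) r = i.+1.
    apply: (find_first _ 0); [lia|by rewrite ri1|].
    move=> j ji; case: (ltngtP j i) => ij; [|lia|by rewrite ij ri ltnn].
    by have := @incr_nth_lt r j i sr; lia.
  by rewrite ltn_eqF // ri1 eqxx -[in x \in r]ri mem_nth // ltnW.
Qed.

(** The appended [x] commutes left past all entries after [y]. In the braid case [x y x] then
    becomes [y x y]. Finally [y] commutes to the front past entries smaller than [x]. *)
Lemma row_ins_beqv x r r' y : sorted ltn r -> row_ins x r r' (Some y) ->
  beqv (rcons r x) (y :: r').
Proof.
(* In both cases [i] is the position of the bumped letter [y]; in the braid case [x] stands at
   [i.-1]. *)
move=> sr H; have {H} : exists2 i, i < size r /\ nth 0 r i = y &
   (x < y /\ (forall j, j < i -> nth 0 r j < x)) /\ r' = set_nth 0 r i x \/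
   [/\ 0 < i, nth 0 r i.-1 = x, y = x.+1 & r' = r].
  move: H; move Eo: (Some y) => o H.
  case: H Eo => [//|i y' ir ri xy H [->]|i ir ri ri1 [->]].
    by exists i => //; left.
  by exists i.+1 => //; right.
case=> i [ir ri]; have le j k := @incr_nth_lt r j k sr.
have all2 : x < y -> all (fun z => (x.+1 < z) || (z.+1 < x)) (drop i.+1 r).
  move=> xy; apply/(all_nthP 0) => j; rewrite size_drop nth_drop => jr.
  by have := le i (i.+1 + j); lia.
case=> [[[xy H] ->]|[i0 ri1 yx ->]].
  rewrite set_nthE ir -{1}(cat_take_drop i r) (drop_nth 0) // ri.
  rewrite rcons_cat /= -(cat_rcons y) -cat_cons.
  apply: beqv_trans (beqv_catl _ _ _ (beqv_comm_seq _ _ (all2 xy))) _.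
  apply: beqv_catr.
  apply: beqv_comm_seq; apply/(all_nthP 0) => j.
  rewrite size_takel; last lia.
  by move=> ji; rewrite nth_take // ; have := H _ ji; lia.
have e : r = take i.-1 r ++ [:: x; y] ++ drop i.+1 r.
  rewrite -{1}(cat_take_drop i.-1 r) (drop_nth 0) ?ri1; last lia.
  by rewrite prednK // (drop_nth 0) // ri.
rewrite {1 2}e -cat_cons -[rcons _ _]cats1 -!catA.
have : beqv (drop i.+1 r ++ [:: x]) (x :: drop i.+1 r).
  by rewrite cats1; apply: beqv_comm_seq; apply: all2; lia.
move=> /(beqv_catl (take i.-1 r ++ [:: x; y])); rewrite -catA => h.
apply: beqv_trans h _.
have /(beqv_ctx (take i.-1 r) (drop i.+1 r)) := beqv_braid x.
rewrite -yx -catA => h; apply: beqv_trans h _.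
rewrite -(cat1s y [:: x; y]) -!catA catA cats1; apply: (beqv_catr _ _ (y :: take i.-1 r)).
apply: beqv_comm_seq; apply/(all_nthP 0) => j.
rewrite size_takel; last lia.
by move=> ji; rewrite nth_take //; have := le j i.-1; lia.
Qed.

Lemma row_ins_sorted x r r' o : sorted ltn r -> row_ins x r r' o -> sorted ltn r'.
Proof.
move=> sr [H|i y ir ri xy H|//].
  apply/(sortedP 0) => j; rewrite size_rcons ltnS => jr; rewrite !nth_rcons jr.
  case: ltnP => h; first by apply: incr_nth_lt.
  by rewrite /= (_ : j.+1 == size r) ?H //; lia.
apply/(sortedP 0) => j; rewrite size_set_nth (maxn_idPr ir) => jr.
rewrite !nth_set_nth /=; have := H j; have := @incr_nth_lt r j j.+1 sr.
have := @incr_nth_lt r i j.+1 sr.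
by do 2! case: eqP; lia.
Qed.

Lemma row_ins_mem x r r' o : row_ins x r r' o -> x \in r'.
Proof.
case=> [H|i y ir ri xy H|i ir ri ri1]; first by rewrite mem_rcons mem_head.
  by apply/(nthP 0); exists i; rewrite ?size_set_nth ?nth_set_nth /= ?eqxx ?leq_maxl.
by rewrite -ri mem_nth // ltnW.
Qed.

Lemma row_ins_size x r r' o : row_ins x r r' o -> size r' = (o == None) + size r.
Proof.
case=> [H|i y ir ri xy H|//]; first by rewrite size_rcons.
by rewrite size_set_nth /=; lia.
Qed.

(* The bumped letters compare in the same way as the inserted ones, with [None] as infinity. *)
Lemma row_ins2 a b r r1 r2 o1 o2 : sorted ltn r -> row_ins a r r1 o1 ->
  row_ins b r1 r2 o2 ->
  (a < b -> if o2 is Some z then if o1 is Some y then y < z else false else true) /\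
  (b < a -> if o2 is Some z then if o1 is Some y then z < y else true else false).
Proof.
move=> sr H1 H2; have := row_ins_sorted _ _ _ _ sr H1.
case: H1 H2 => [H|i y ir ri xy H|i ir ri ri1]; last 1 first.
- case=> [H2 sr1|j z jr rj xz H2 sr1|j jr rj rj1 sr1].
  + by have := H2 i.+1 ir; split=> //; lia.
  + have := @incr_nth_lt r j i.+1 sr; have := H2 i; have := H2 i.+1.
    by case: (ltngtP i.+1 j) => h; split; try lia; move: h rj ri1 => <-; lia.
  + have := @incr_nth_lt r i j sr; have := @incr_nth_lt r j i sr.
    by case: (ltngtP i j) => h; split; try lia; move: h rj ri => <-; lia.
- case=> [H2 sr1|j z jr rj xz H2 sr1|j jr rj rj1 sr1].
  + split=> // ba; have := H2 (size r).
    by rewrite size_rcons nth_rcons ltnn eqxx; lia.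
  + split=> //; move: rj jr; rewrite size_rcons nth_rcons.
    case: ifP => [jr rj _|_]; first by have := H j; lia.
    by case: eqP => [*|]; lia.
  + split=> //; move: rj1 jr; rewrite size_rcons nth_rcons.
    case: ifP => [jr rj1 _|_]; first by have := H j.+1; lia.
    by case: eqP => [*|]; lia.
- case=> [H2 sr1|j z jr rj xz H2 sr1|j jr rj rj1 sr1].
  + split=> // ba; have := H2 i.
    by rewrite size_set_nth nth_set_nth /= eqxx; lia.
  + have := @incr_nth_lt _ i j sr1; have := H2 i.
    have := @incr_nth_lt _ j i sr1; have := @incr_nth_lt _ i j sr.
    move: rj jr; rewrite size_set_nth (maxn_idPr ir) !nth_set_nth /= eqxx.
    by case: (eqVneq j i) => h; split; lia.
  + have := @incr_nth_lt _ i j.+1 sr1.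
    have := @incr_nth_lt _ j.+1 i sr1; have := @incr_nth_lt _ i j.+1 sr.
    move: rj rj1 jr; rewrite size_set_nth (maxn_idPr ir) !nth_set_nth /= eqxx.
    by case: (eqVneq j.+1 i) => h; case: (eqVneq j i) => h'; split; lia.
Qed.

(** * Reversing the insertion into a row *)

Definition uninsert_row (r : seq nat) y :=
  if y \in r then (r, y.-1)
  else let i := (find (fun z => y < z) r).-1 in (set_nth 0 r i y, nth 0 r i).

(** A genuine bump removes [y] from the row, so finding [y] in the new row signals the braid case.
    Otherwise [x] stands just before the first entry above [y]. *)
Lemma row_insK x r r' y : sorted ltn r -> row_ins x r r' (Some y) ->
  uninsert_row r' y = (r, x).
Proof.
move=> sr; move Eo: (Some y) => o H; rewrite /uninsert_row.
case: H Eo => [//|i z ir ri xz H [->]|i ir ri ri1 [->]]; last first.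
  by rewrite -[X in X \in _]ri1 mem_nth.
have le := fun j k => @incr_nth_lt r j k sr.
have s' : size (set_nth 0 r i x) = size r by rewrite size_set_nth (maxn_idPr ir).
case: ifP => [/mem_nth_ex [j]|_].
  rewrite s' nth_set_nth /=; case: (ltngtP j i) => ij jr rj; last lia.
    by have := le j i; lia.
  by have := le i j; lia.
have -> : find (fun y => z < y) (set_nth 0 r i x) = i.+1.
  apply: (find_first _ 0); rewrite ?s' //.
    by move=> i1; have := le i i.+1; rewrite nth_set_nth /=; case: eqP => [|]; lia.
  move=> j ji; rewrite nth_set_nth /=; have := le j i.
  by case: eqP => [|]; lia.
rewrite /= nth_set_nth /= eqxx; congr (_, _).
apply: (@eq_from_nth _ 0) => [|j jr]; rewrite ?size_set_nth ?s' ?(maxn_idPr ir) //.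
by do 2! rewrite nth_set_nth /=; case: (eqVneq j i) => [->|_].
Qed.

(** The bound on the first entry provides a letter below [y] to be released. If [y] is in the row,
    [y.-1] must precede it and the step was a braid; otherwise [y] replaces the last entry below
    it. *)
Lemma row_ins_surj r' y : sorted ltn r' -> nth 0 r' 0 < y -> 0 < size r' ->
  breduced (y :: r') -> exists r x, sorted ltn r /\ row_ins x r r' (Some y).
Proof.
move=> sr r0 s0 R; have le := fun j k => @incr_nth_lt r' j k sr.
case: (boolP (y \in r')) => [/mem_nth_ex [i ir ri]|yr].
  case: i ir ri => [|i] ir ri; first lia.
  suff ri1 : nth 0 r' i = y.-1.
    by exists r', y.-1; split=> //; rewrite -{2}(@prednK y); [apply: (RowBraid _ _ i)|]; lia.
  case: (eqVneq (nth 0 r' i) y.-1) => // ne; exfalso.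
  (* All entries before this [y] are now below [y.-1], so the [y] at the front commutes past them
     and meets it. *)
  apply: (R (take i.+1 r') y (drop i.+2 r')).
  rewrite -{1}(cat_take_drop i.+1 r') (drop_nth 0) // ri -cat_cons -[X in beqv _ X]cat_rcons.
  apply: beqv_catr; apply: beqv_sym; apply: beqv_comm_seq.
  apply/(all_nthP 0) => j; rewrite size_takel; last exact: ltnW.
  move=> ji; rewrite nth_take //.
  by have := le j i; have := le i i.+1; case: (eqVneq j i) => [->|]; lia.
set f := find (fun z => y < z) r'.
have fr : f <= size r' by exact: find_size.
have fy : f < size r' -> y < nth 0 r' f by rewrite -has_find => /(nth_find 0).
have lt j : j < f -> nth 0 r' j < y.
  move=> jf; have := before_find 0 jf => /= ?.
  suff : nth 0 r' j != y by lia.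
  by apply: contraNneq yr => <-; rewrite mem_nth //; apply: leq_trans fr.
clearbody f; case: f fr fy lt => [|i] ir fy lt; first by have := fy s0; lia.
have xy := lt i (ltnSn i).
have s' : size (set_nth 0 r' i y) = size r' by rewrite size_set_nth (maxn_idPr ir).
exists (set_nth 0 r' i y), (nth 0 r' i); split.
  apply/(sortedP 0) => j; rewrite s' => jr; rewrite !nth_set_nth /=.
  have := le j j.+1; have := le j i; have := lt j.
  by case: (eqVneq j i) => [ji|_]; case: (eqVneq j.+1 i) => [ji'|_]; rewrite ?ji; lia.
have e : r' = set_nth 0 (set_nth 0 r' i y) i (nth 0 r' i).
  apply: (@eq_from_nth _ 0) => [|j jr]; rewrite ?size_set_nth ?s' ?(maxn_idPr ir) //.
  by do 2! rewrite nth_set_nth /=; case: (eqVneq j i) => [->|_].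
rewrite {3}e; apply: RowBump; rewrite ?s' ?nth_set_nth /= ?eqxx // => j ji.
by rewrite nth_set_nth /=; have := le j i; case: eqP; lia.
Qed.

(** * Strict columns between consecutive rows *)

Definition col_dom (r1 r2 : seq nat) :=
  size r2 <= size r1 /\ forall j, j < size r2 -> nth 0 r1 j < nth 0 r2 j.

(** Whether by a bump or a braid, [x] occupies column [i] of [r1'], and the entry of [r2] in that
    column, if any, is at least [y]. So a newly placed [y] lands weakly left of column [i], under an
    entry at most [x], hence below [y]. *)
Lemma row_ins_dom x y r1 r1' r2 r2' o : sorted ltn r1 -> sorted ltn r2 ->
  row_ins x r1 r1' (Some y) -> row_ins y r2 r2' o -> col_dom r1 r2 -> col_dom r1' r2'.
Proof.
move=> s1 s2; have l1 := fun j k => @incr_nth_lt r1 j k s1.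
have l2 := fun j k => @incr_nth_lt r2 j k s2.
move Ey: (Some y) => oy H1.
case: H1 Ey => [//|i y' ir ri xy H1 [->]|i ir ri ri1 [->]].
all: case=> [H2|j z jr rj yz H2|j jr rj rj1] [ds d].
all: split; rewrite ?size_rcons ?size_set_nth ?(maxn_idPr ir) ?(maxn_idPr jr) //.
- case: (ltnP i (size r2)) => h; last lia.
  by have := d _ h; have := H2 _ h; lia.
- move=> p; rewrite ltnS leq_eqVlt => /orP [/eqP ->|pr]; last first.
    by rewrite nth_rcons pr nth_set_nth /=; have := d _ pr; case: eqP => [->|]; lia.
  rewrite nth_rcons ltnn eqxx nth_set_nth /=; case: eqP => // ne.
  case: (ltnP i (size r2)) => h; last by have := l1 (size r2) i; lia.
  by have := d _ h; have := H2 _ h; lia.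
- move=> p pr; have ji : j <= i.
    by rewrite leqNgt; apply/negP => h; have := d i; have := H2 i; lia.
  rewrite !nth_set_nth /=; have := d p pr; have := l1 p i.
  by case: (eqVneq p i) => [?|?]; case: (eqVneq p j) => [?|?]; subst; lia.
- move=> p pr; rewrite nth_set_nth /=; have := d p pr.
  by case: eqP => [->|]; lia.
- case: (ltnP i (size r2)) => h; last lia.
  by have := d _ h; have := H2 _ h; lia.
- move=> p; rewrite ltnS leq_eqVlt => /orP [/eqP ->|pr]; last first.
    by rewrite nth_rcons pr; apply: d.
  rewrite nth_rcons ltnn eqxx; have := l1 (size r2) i.+1.
  case: (ltnP i (size r2)) => h; last by lia.
  by have := d _ h; have := H2 _ h; lia.
- move=> p pr; have ji : j <= i.
    by rewrite leqNgt; apply/negP => h; have := d i; have := H2 i; lia.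
  rewrite !nth_set_nth /=; have := d p pr; have := l1 p i.+1.
  by case: eqP => [?|?]; subst; lia.
Qed.

Lemma row_ins_dom_inv x y r1 r1' r2 r2' o : sorted ltn r1 -> sorted ltn r2 ->
  row_ins x r1 r1' (Some y) -> row_ins y r2 r2' o -> col_dom r1' r2' -> col_dom r1 r2.
Proof.
move=> s1 s2; have l1 := fun j k => @incr_nth_lt r1 j k s1.
have l2 := fun j k => @incr_nth_lt r2 j k s2.
move Ey: (Some y) => oy H1.
case: H1 Ey => [//|i y' ir ri xy H1 [->]|i ir ri ri1 [->]].
all: case=> [H2|j z jr rj yz H2|j jr rj rj1] [].
all: rewrite ?size_rcons ?size_set_nth ?(maxn_idPr ir) ?(maxn_idPr jr) //.
all: move=> ds d; split=> [|p pr]; try lia; have dp := d p.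
- have := d (size r2); move: dp; rewrite !nth_rcons pr ltnn eqxx !nth_set_nth /=.
  have := l1 i (size r2); have := l1 i p.
  by case: (eqVneq p i) => [?|?]; case: (eqVneq (size r2) i) => [?|?]; subst; lia.
- have := d j; have := d i; move: dp; rewrite !nth_set_nth /= !eqxx.
  have := l1 i j; have := l2 j i.
  case: (eqVneq j i) => [?|?]; first by subst; case: (eqVneq p i) => [?|?]; subst; lia.
  case: (eqVneq i j) => [?|?]; first by subst; lia.
  by case: (eqVneq p i) => [?|?]; case: (eqVneq p j) => [?|?]; subst; lia.
- have := d j.+1; move: dp; rewrite !nth_set_nth /=.
  have := l1 i j.+1; have := l2 j.+1 i.
  by case: (eqVneq p i) => [?|?]; case: (eqVneq j.+1 i) => [?|?]; subst; lia.
- by move: dp; rewrite nth_rcons pr; lia.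
- by move: dp; rewrite nth_set_nth /=; case: eqP => [?|?]; subst; lia.
Qed.

(** * Insertion into a tableau *)

(** Recursive form of the tableau conditions (see [tabP]), suited to induction along an insertion.
    Under the last row, [head] supplies an empty row, for which [col_dom] is vacuous. *)
Fixpoint tab (t : seq (seq nat)) : Prop :=
  if t is r :: t' then
    [/\ sorted ltn r, r != [::], col_dom r (head [::] t') & tab t']
  else True.

Lemma tab_head t : tab t -> sorted ltn (head [::] t).
Proof. by case: t => [|r t] // []. Qed.

Lemma reading_word_cons r t : reading_word (r :: t) = reading_word t ++ r.
Proof. by rewrite /reading_word rev_cons flatten_rcons. Qed.

Lemma row_ins_None x r r' : row_ins x r r' None -> r' = rcons r x.
Proof. by move Eo: None => o H; case: H Eo. Qed.

Lemma row_insP x r r' o u : sorted ltn r -> breduced (u ++ rcons r x) ->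
  eg_insert_row r x = (r', o) -> row_ins x r r' o.
Proof. by move=> sr /breduced_catr R E; have := eg_insert_rowP _ _ sr R; rewrite E. Qed.

Lemma row_ins_word x r r' y u : sorted ltn r -> row_ins x r r' (Some y) ->
  beqv (u ++ rcons r x) (rcons u y ++ r').
Proof. by rewrite cat_rcons => sr H; apply/beqv_catl/row_ins_beqv. Qed.

(** The row step turns the word into [rcons (reading_word t) y] followed by the new row, so the
    induction applies to the lower rows with letter [y]. The last conjunct exposes the step in the
    first row, which [row_ins_dom] needs for the row above. *)
Lemma eg_insert_spec t x t' m : tab t -> breduced (rcons (reading_word t) x) ->
  eg_insert t x = (t', m) ->
  [/\ tab t', beqv (rcons (reading_word t) x) (reading_word t'),
      shape t' = incr_nth (shape t) m
    & exists o, row_ins x (head [::] t) (head [::] t') o].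
Proof.
elim: t x t' m => [|r t IH] x t' m.
  move=> _ _ [<- <-]; split=> //; first exact: beqv_refl.
  by exists None; apply: (@RowAppend x [::]).
case=> sr r0 d tt /=; rewrite reading_word_cons rcons_cat => R.
case E: (eg_insert_row r x) => [r' [y|]]; have H := row_insP _ _ _ _ _ sr R E; last first.
  have e := row_ins_None _ _ _ H; subst r'; case=> <- <-; split=> //=.
  - split=> //; first exact: row_ins_sorted H.
      by case: (r).
    case: d => ds d; split=> [|j jt]; rewrite ?size_rcons; first lia.
    by rewrite nth_rcons (leq_trans jt ds); apply: d.
  - by rewrite reading_word_cons; apply: beqv_refl.
  - by rewrite size_rcons.
  - by exists None.
have e := row_ins_word _ _ _ _ (reading_word t) sr H.
case E2: (eg_insert t y) => [t2 m2] [<- <-].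
have [] := IH _ _ _ tt (breduced_catl _ _ (breduced_eqv _ _ e R)) E2.
move=> t2t e2 s2 [o Ho]; split=> /=.
- split=> //; first exact: row_ins_sorted H.
    by rewrite -size_eq0 (row_ins_size _ _ _ _ H) add0n size_eq0.
  by apply: row_ins_dom H Ho d => //; apply: tab_head.
- rewrite reading_word_cons; apply: beqv_trans e _; exact: beqv_catr.
- by rewrite s2 (row_ins_size _ _ _ _ H).
- by exists (Some y).
Qed.

(** The size hypothesis says that row [m] ends in a corner. Its last letter is removed and passed
    upwards, each row above taking it in and releasing a smaller one. *)
Lemma eg_insert_surj t' m : tab t' -> breduced (reading_word t') ->
  nth 0 (shape t') m.+1 < nth 0 (shape t') m ->
  exists t x, [/\ tab t, eg_insert t x = (t', m),
    beqv (rcons (reading_word t) x) (reading_word t')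
  & exists o, row_ins x (head [::] t) (head [::] t') o].
Proof.
elim: t' m => [|r' t' IH] m; first by move=> _ _ /=; rewrite nth_nil.
case=> sr r0 d tt; rewrite reading_word_cons => R.
case: m => [|m] /= hm.
  case/lastP: r' sr r0 d R hm => [//|r x] src r0 d R hm.
  have sr : sorted ltn r by move: src; rewrite -cats1 => /cat_sorted2 [].
  have H : row_ins x r (rcons r x) None.
    apply: RowAppend => j jr.
    have := @incr_nth_lt _ j (size r) src.
    by rewrite size_rcons !nth_rcons jr ltnn eqxx; apply.
  have E := row_insE _ _ _ _ sr H.
  (* If the first row loses its only box, the corner condition leaves no row below, and the earlier
     tableau is empty rather than a list with an empty row. *)
  case: (eqVneq r [::]) => [r1|r1].
    exists [::], x; move: hm; rewrite r1 size_rcons.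
    case: t' {d R IH} tt => [|[|z r2] t'] tt; [|by case: tt|by []].
    move=> _; split=> //; first exact: beqv_refl.
    by exists None; apply: (@RowAppend x [::]).
  exists (r :: t'), x; split=> //=.
  - split=> //.
    move: hm d; rewrite size_rcons => hm [_ d]; split.
      by case: (t') hm.
    move=> j jt; have := d j jt; rewrite nth_rcons.
    suff -> : j < size r by [].
    by case: (t') hm jt => //= *; lia.
  - by rewrite E.
  - by rewrite reading_word_cons rcons_cat; apply: beqv_refl.
  - by exists None.
have [t [y [tt' E e [o Ho]]]] := IH _ tt (breduced_catl _ _ R) hm.
(* [y] lies in the first row of [t'], whose entries all exceed the first entry of [r']. *)
have y0 : nth 0 r' 0 < y.
  have /mem_nth_ex [j jr <-] := row_ins_mem _ _ _ _ Ho.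
  have [ds d0] := d; apply: leq_trans (d0 0 _) _; first lia.
  case: j jr => [//|j jr].
  by apply: ltnW; apply: incr_nth_lt (tab_head _ tt) _ _.
have e1 : beqv (reading_word t' ++ r') (reading_word t ++ y :: r').
  by rewrite -cat_rcons; apply/beqv_catr/beqv_sym.
have [||r [x [sr' H]]] := row_ins_surj _ _ sr y0.
- by rewrite lt0n size_eq0.
- exact: breduced_catr (breduced_eqv _ _ e1 R).
have Er := row_insE _ _ _ _ sr' H.
exists (r :: t), x; split=> /=.
- split=> //; first by rewrite -size_eq0 -[size r]add0n -(row_ins_size _ _ _ _ H) size_eq0.
  by apply: row_ins_dom_inv H Ho d => //; apply: tab_head.
- by rewrite Er E.
- rewrite !reading_word_cons rcons_cat; apply: beqv_trans (beqv_sym _ _ e1).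
  by rewrite -cat_rcons; apply: row_ins_word.
- by exists (Some y).
Qed.

(** The common index [m] forces both insertions to bump or both to append in each row. After a bump
    the induction gives equal lower rows and bumped letters, and [row_insK] recovers the row and the
    letter. Appending to a nonempty row never yields a single box, which excludes an empty tableau
    against a nonempty one. *)
Lemma eg_insert_inj t1 t2 x1 x2 t m : tab t1 -> tab t2 ->
  breduced (rcons (reading_word t1) x1) -> breduced (rcons (reading_word t2) x2) ->
  eg_insert t1 x1 = (t, m) -> eg_insert t2 x2 = (t, m) -> t1 = t2 /\ x1 = x2.
Proof.
elim: t1 t2 x1 x2 t m => [|r1 t1 IH] [|r2 t2] x1 x2 t m.
- by move=> _ _ _ _ /= [<- <-] [->].
- move=> _ [sr r0 d tt] _; rewrite reading_word_cons rcons_cat => R /= [<- <-].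
  case E: (eg_insert_row r2 x2) => [r' [y|]]; first by case: eg_insert.
  have -> := row_ins_None _ _ _ (row_insP _ _ _ _ _ sr R E).
  by case: (r2) r0 => // a [].
- case=> sr r0 d tt _; rewrite reading_word_cons rcons_cat => R _ + [Et Em]; rewrite -{}Et -{}Em /=.
  case E: (eg_insert_row r1 x1) => [r' [y|]]; first by case: eg_insert.
  have -> := row_ins_None _ _ _ (row_insP _ _ _ _ _ sr R E).
  by case: (r1) r0 => // a [].
move=> [s1 _ _ tt1] [s2 _ _ tt2]; rewrite !reading_word_cons !rcons_cat /= => R1 R2.
case E1: (eg_insert_row r1 x1) => [r1' o1]; case E2: (eg_insert_row r2 x2) => [r2' o2].
have H1 := row_insP _ _ _ _ _ s1 R1 E1; have H2 := row_insP _ _ _ _ _ s2 R2 E2.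
case: o1 o2 => [y1|] [y2|] in E1 E2 H1 H2 *.
- case F1: (eg_insert t1 y1) => [t1' m1]; case F2: (eg_insert t2 y2) => [t2' m2].
  move=> [<- <-] [e1 e2 e3]; subst t2' m2 r2'.
  have B1 := breduced_catl _ _ (breduced_eqv _ _ (row_ins_word _ _ _ _ _ s1 H1) R1).
  have B2 := breduced_catl _ _ (breduced_eqv _ _ (row_ins_word _ _ _ _ _ s2 H2) R2).
  have [? ?] := IH _ _ _ _ _ tt1 tt2 B1 B2 F1 F2; subst.
  have := row_insK _ _ _ _ s1 H1; rewrite (row_insK _ _ _ _ s2 H2).
  by case=> -> ->.
- by case: eg_insert => ? ? [_ <-].
- by move=> [_ <-]; case: eg_insert.
rewrite (row_ins_None _ _ _ H1) (row_ins_None _ _ _ H2) => [[<- <-]] [/rcons_inj].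
by case=> -> -> ->.
Qed.

(** While both insertions bump, [row_ins2] transports the comparison of letters from row to row; its
    convention for [None] then decides which insertion stops first. *)
Lemma eg_insert2 a b t t1 t2 m1 m2 : all (sorted ltn) t ->
  breduced (rcons (rcons (reading_word t) a) b) ->
  eg_insert t a = (t1, m1) -> eg_insert t1 b = (t2, m2) ->
  (a < b -> m2 <= m1) /\ (b < a -> m1 < m2).
Proof.
elim: t a b t1 t2 m1 m2 => [|r t IH] a b t1 t2 m1 m2.
  move=> _ R /= [<- <-] /=.
  (* The empty tableau is treated as an empty row to which [a] is appended. *)
  have := @row_ins2 a b [::] [:: a] _ None _ isT (@RowAppend a [::] _).
  case E: (eg_insert_row [:: a] b) => [r' o].
  have H := row_insP b [:: a] _ _ [::] isT R E.
  move=> /(_ _ _ (fun j => ltac:(done)) H).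
  by case: o => [y|] in E H * => -[H1 H2] [_ <-]; split => // /H1 // /H2.
case/andP=> sr st; rewrite reading_word_cons !rcons_cat /= => R.
have R1 : breduced (reading_word t ++ rcons r a).
  by move: R; rewrite -[rcons (rcons r a) b]cats1 catA => /breduced_catl.
case Ea: (eg_insert_row r a) => [r1 o1]; have Ha := row_insP _ _ _ _ _ sr R1 Ea.
have sr1 := row_ins_sorted _ _ _ _ sr Ha.
case: o1 => [y|] in Ea Ha *.
  have e := row_ins_word _ _ _ _ (reading_word t) sr Ha.
  have R2 : breduced (rcons (reading_word t) y ++ rcons r1 b).
    apply: breduced_eqv R; have := beqv_catr [:: b] _ _ e.
    by rewrite !cats1 !rcons_cat.
  case F1: (eg_insert t y) => [t1' m1'] [<- <-] /=.
  case Eb: (eg_insert_row r1 b) => [r2 o2]; have Hb := row_insP _ _ _ _ _ sr1 R2 Eb.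
  have := row_ins2 _ _ _ _ _ _ _ sr Ha Hb.
  case: o2 => [z|] in Eb Hb * => -[H1 H2].
    have e2 := row_ins_word _ _ _ _ (rcons (reading_word t) y) sr1 Hb.
    have R3 := breduced_catl _ _ (breduced_eqv _ _ e2 R2).
    case F2: (eg_insert t1' z) => [t2' m2'] [_ <-].
    have [G1 G2] := IH _ _ _ _ _ _ st R3 F1 F2.
    by split=> [/H1/G1|/H2/G2].
  by move=> [_ <-]; split=> // /H2.
have e := row_ins_None _ _ _ Ha; subst r1; move=> [<- <-] /=.
case Eb: (eg_insert_row (rcons r a) b) => [r2 o2].
have Hb := row_insP _ _ _ _ _ sr1 R Eb.
have := row_ins2 _ _ _ _ _ _ _ sr Ha Hb.
case: o2 => [z|] in Eb Hb * => -[H1 H2].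
  by case: eg_insert => ? ? [_ <-]; split=> // /H1.
by move=> [_ <-]; split=> // /H2.
Qed.

(** * Fillings and primed tableaux *)

Lemma nth_shapeE (T : Type) (t : seq (seq T)) i :
  nth 0 (shape t) i = size (nth [::] t i).
Proof.
case: (ltnP i (size t)) => it; first by rewrite (nth_map [::]).
by rewrite !nth_default ?size_map.
Qed.

Lemma is_partitionP (T : Type) (t : seq (seq T)) : is_partition (shape t) <->
  (forall i, i < size t -> 0 < size (nth [::] t i)) /\
  (forall i, size (nth [::] t i.+1) <= size (nth [::] t i)).
Proof.
split=> [/andP [/(sortedP 0) s /(all_nthP 0) p]|[p s]].
  rewrite size_map in s p; split=> i; first by move/p; rewrite nth_shapeE.
  case: (ltnP i.+1 (size t)) => h; last by rewrite (nth_default _ h).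
  by have := s i h; rewrite /= !nth_shapeE.
apply/andP; split; first by apply/(sortedP 0) => i _; rewrite /= !nth_shapeE.
by apply/(all_nthP 0) => i; rewrite size_map nth_shapeE; apply: p.
Qed.

Lemma rows_relP (T : Type) (x0 : T) R (t : seq (seq T)) : rows_rel R t <->
  forall i j, j.+1 < size (nth [::] t i) ->
    R (nth x0 (nth [::] t i) j) (nth x0 (nth [::] t i) j.+1).
Proof.
split=> [/(all_nthP [::]) h i j|h].
  case: (ltnP i (size t)) => it; last by rewrite (nth_default _ it).
  by move=> jt; apply/sortedP => //; apply: h.
by apply/(all_nthP [::]) => i it; apply/(sortedP x0) => j; apply: h.
Qed.

Lemma cols_relP (T : Type) (x0 : T) R (t : seq (seq T)) : cols_rel x0 R t <->
  forall i j, j < size (nth [::] t i.+1) ->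
    R (nth x0 (nth [::] t i) j) (nth x0 (nth [::] t i.+1) j).
Proof.
split=> [/forallP h i j jt|h]; last by apply/forallP => i; apply/forallP => j; apply: h.
have it : i < size t.
  by apply: ltnW; rewrite ltnNge; apply: contraTN jt => /(nth_default [::]) ->.
by have /forallP /(_ (Ordinal jt)) := h (Ordinal it).
Qed.

Lemma tab_nthP t : tab t <-> [/\ forall i, sorted ltn (nth [::] t i),
  forall i, i < size t -> 0 < size (nth [::] t i)
  & forall i, col_dom (nth [::] t i) (nth [::] t i.+1)].
Proof.
elim: t => [|r t IH]; first by split=> // _; split=> // i; rewrite ?nth_nil //; split; rewrite !nth_nil.
split=> [[sr r0 d /IH [h1 h2 h3]]|[h1 h2 h3]].
  split=> -[|i] /=; [by []|exact: h1|by move=> _; rewrite lt0n size_eq0|exact: h2|by rewrite nth0|exact: h3].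
split; [exact: h1 0|by rewrite -size_eq0 -lt0n; apply: (h2 0)|by have := h3 0; rewrite /= nth0|].
by apply/IH; split=> i; [apply: (h1 i.+1)|apply: (h2 i.+1)|apply: (h3 i.+1)].
Qed.

Lemma tabP t : tab t <->
  [/\ is_partition (shape t), rows_rel ltn t & cols_rel 0 ltn t].
Proof.
split=> [/tab_nthP [h1 h2 h3]|[/is_partitionP [p1 p2] /(rows_relP _ 0) h /(cols_relP _ 0) h']].
  split; first by apply/is_partitionP; split=> // i; case: (h3 i).
    by apply/(rows_relP _ 0) => i; apply/sortedP.
  by apply/(cols_relP _ 0) => i; case: (h3 i).
by apply/tab_nthP; split=> // i; [apply/(sortedP 0) => j; apply: h|split=> // j; apply: h'].
Qed.

Notation ent Q i j := (nth (0, false) (nth [::] Q i) j).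

Definition row_ok : rel plet := fun x y => ple x y && ((x == y) ==> ~~ x.2).
Definition col_ok : rel plet := fun x y => ple x y && ((x == y) ==> x.2).

Lemma all_all_flatten (T : Type) (p : pred T) t : all (all p) t = all p (flatten t).
Proof. by elim: t => //= r t ->; rewrite all_cat. Qed.

Lemma primedP k Q : primed_tableau k Q <-> [/\ is_partition (shape Q),
  forall x, x \in flatten Q -> 1 <= x.1 <= k,
  forall i j, j.+1 < size (nth [::] Q i) -> row_ok (ent Q i j) (ent Q i j.+1)
  & forall i j, j < size (nth [::] Q i.+1) -> col_ok (ent Q i j) (ent Q i.+1 j)].
Proof.
rewrite /primed_tableau all_all_flatten.
split=> -[h1 h2 h3 h4]; split=> //; try exact/allP.
- exact/(rows_relP _ (0, false)).
- exact/(cols_relP _ (0, false)).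
- exact/(rows_relP _ (0, false)).
- exact/(cols_relP _ (0, false)).
Qed.

(** Positivity matters: truncated subtraction gives [(0, true)] and [(0, false)] the same rank. *)
Lemma prank_inj (x y : plet) : 0 < x.1 -> 0 < y.1 -> prank x = prank y -> x = y.
Proof.
by case: x y => [a []] [b []]; rewrite /prank /= => *; congr (_, _); lia.
Qed.

Lemma ent_flatten (Q : seq (seq plet)) i j : j < size (nth [::] Q i) -> ent Q i j \in flatten Q.
Proof.
move=> ji; apply/flattenP; exists (nth [::] Q i); last exact: mem_nth.
by apply: mem_nth; rewrite ltnNge; apply: contraTN ji => /(nth_default [::]) ->.
Qed.

Lemma row_flatten (Q : seq (seq plet)) i x : x \in nth [::] Q i -> x \in flatten Q.
Proof. by move/(nthP (0, false)) => [j ji <-]; apply: ent_flatten. Qed.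

Lemma flatten_row (Q : seq (seq plet)) x : x \in flatten Q -> exists i, x \in nth [::] Q i.
Proof. by case/flattenP => r /(nthP [::]) [i _ <-] xr; exists i. Qed.

Lemma eq_filling (Q1 Q2 : seq (seq plet)) : shape Q1 = shape Q2 ->
  (forall i j, j < size (nth [::] Q1 i) -> ent Q1 i j = ent Q2 i j) -> Q1 = Q2.
Proof.
move=> s e; apply: (@eq_from_nth _ [::]) => [|i _]; first by have := congr1 size s; rewrite !size_map.
by apply: (@eq_from_nth _ (0, false)) => [|j /e //]; rewrite -!nth_shapeE s.
Qed.

Definition addbox (Q : seq (seq plet)) m x :=
  set_nth [::] Q m (rcons (nth [::] Q m) x).

Section AddBox.
Context (Q : seq (seq plet)) (m : nat) (x : plet).

Lemma row_addbox i : nth [::] (addbox Q m x) i =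
  if i == m then rcons (nth [::] Q m) x else nth [::] Q i.
Proof. by rewrite nth_set_nth. Qed.

Lemma size_row_addbox i :
  size (nth [::] (addbox Q m x) i) = (i == m) + size (nth [::] Q i).
Proof. by rewrite row_addbox; case: eqP => // ->; rewrite size_rcons. Qed.

Lemma ent_addbox i j : ent (addbox Q m x) i j =
  if (i == m) && (j == size (nth [::] Q m)) then x else ent Q i j.
Proof.
rewrite row_addbox; case: eqP => //= ->; rewrite nth_rcons.
by case: ltngtP => // h; rewrite nth_default // ltnW.
Qed.

Lemma shape_addbox : shape (addbox Q m x) = incr_nth (shape Q) m.
Proof.
apply: (@eq_from_nth _ 0) => [|i _].
  rewrite size_map size_set_nth size_incr_nth size_map.
  by case: ltnP => h; lia.
by rewrite nth_incr_nth !nth_shapeE size_row_addbox eq_sym.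
Qed.

Lemma count_addbox p : count p (flatten (addbox Q m x)) = p x + count p (flatten Q).
Proof.
rewrite /addbox; elim: Q m => [|r Q' IH] [|m'] /=; rewrite ?cats0 ?addn0 //.
- by elim: m' => //= *; rewrite addn0.
- by rewrite !count_cat -cats1 count_cat /=; lia.
- by rewrite !count_cat IH; lia.
Qed.

Lemma mem_addbox y : (y \in flatten (addbox Q m x)) = (y == x) || (y \in flatten Q).
Proof. by rewrite -!has_pred1 !has_count count_addbox /= eq_sym; case: eqP. Qed.

End AddBox.

(** * Words of labelled letters *)

Definition biletter := (nat * plet)%type.

(** The order of signed letters inside blocks, read on absolute values: negative letters come first
    in a block, and increasing negative integers have decreasing absolute values. *)
Definition bilt : rel biletter := fun p q => (prank p.2 < prank q.2) ||
  (p.2 == q.2) && (if p.2.2 then q.1 < p.1 else p.1 < q.1).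

Lemma bilt_trans : transitive bilt.
Proof.
move=> [b y] [a x] [c z]; rewrite /bilt /=.
case/orP=> [xy|/andP [/eqP <- ab]]; case/orP=> [yz|/andP [/eqP <- bc]].
- by rewrite (ltn_trans xy yz).
- by rewrite xy.
- by rewrite yz.
- by rewrite eqxx ltnn /=; move: ab bc; case: ifP => _; lia.
Qed.

Lemma bilt_prank p q : bilt p q -> prank p.2 <= prank q.2.
Proof. by case/orP=> [/ltnW //|/andP [/eqP -> _]]. Qed.

Lemma pairwise_bilt_rcons s p q :
  pairwise bilt (rcons (rcons s p) q) = pairwise bilt (rcons s p) && bilt p q.
Proof.
rewrite pairwise_rcons all_rcons andbC; case R: (pairwise _ _) => //=.
case pq: (bilt p q) => //=; move: R; rewrite pairwise_rcons => /andP [/allP h _].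
by apply/allP => r /h rp; apply: bilt_trans pq.
Qed.

Definition in_labels k : pred biletter := fun p => 1 <= p.2.1 <= k.

Definition EG_pair (s : seq biletter) := foldl eg_step ([::], [::]) s.

Definition new_row s a := (eg_insert (EG_pair s).1 a).2.

Lemma EG_pair_rcons s a x : EG_pair (rcons s (a, x)) =
  ((eg_insert (EG_pair s).1 a).1, addbox (EG_pair s).2 (new_row s a) x).
Proof.
rewrite /EG_pair foldl_rcons /eg_step /new_row /EG_pair /=.
by case: (eg_insert _ a).
Qed.

(** The counting clause serves both the membership test [EG_inv_mem] and the preservation of
    weights. *)
Definition EG_inv k s := [/\ tab (EG_pair s).1,
  beqv (map fst s) (reading_word (EG_pair s).1),
  shape (EG_pair s).1 = shape (EG_pair s).2,
  primed_tableau k (EG_pair s).2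
  & forall p, count p (flatten (EG_pair s).2) = count p (map snd s)].

(** The strip condition seen from the box about to be added, rows being counted from the top. It
    keeps the filling primed, and later identifies the last box from the recording tableau alone. *)
Definition new_row_extreme s a (x : plet) := forall i, x \in nth [::] (EG_pair s).2 i ->
  if x.2 then i < new_row s a else new_row s a <= i.

Lemma EG_inv_mem k s x : EG_inv k s -> (x \in flatten (EG_pair s).2) = (x \in map snd s).
Proof. by case=> _ _ _ _ c; rewrite -!has_pred1 !has_count c. Qed.

Lemma eg_insert_inv k s a x : EG_inv k s -> breduced (map fst (rcons s (a, x))) ->
  let P := (EG_pair s).1 in
  [/\ tab (eg_insert P a).1,
      beqv (map fst (rcons s (a, x))) (reading_word (eg_insert P a).1)
    & shape (eg_insert P a).1 = incr_nth (shape P) (new_row s a)].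
Proof.
case=> tP e _ _ _; rewrite map_rcons => R P; rewrite /new_row -/P.
have {}e : beqv (rcons (map fst s) a) (rcons (reading_word P) a).
  by rewrite -!cats1; apply: beqv_catr.
case E: (eg_insert P a) => [P' m] /=.
have [? e' ? _] := eg_insert_spec _ _ _ _ tP (breduced_eqv _ _ e R) E.
by split=> //; apply: beqv_trans e'.
Qed.

(** As [x] has maximal rank, only an equal neighbour could spoil the filling. Extremeness excludes
    an equal left neighbour when [x] is primed and an equal upper neighbour when it is not. *)
Lemma EG_inv_rcons k s a x : EG_inv k s -> in_labels k (a, x) ->
  all (fun q => prank q.2 <= prank x) s ->
  breduced (map fst (rcons s (a, x))) -> new_row_extreme s a x ->
  EG_inv k (rcons s (a, x)).
Proof.
move=> I kx sx R K; have [tP' e' s'] := eg_insert_inv _ _ _ _ I R.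
have mQ y : y \in flatten (EG_pair s).2 -> prank y <= prank x.
  by rewrite (EG_inv_mem _ _ _ I) => /mapP [q /(allP sx) h ->].
case: I => _ _ sPQ /primedP [/is_partitionP [_ p] Qk Qr Qc] c.
have [p' _ _] := (tabP _).1 tP'.
rewrite /EG_inv EG_pair_rcons /=; split=> //; first by rewrite shape_addbox -sPQ.
  apply/primedP; rewrite shape_addbox -sPQ -s'; split=> //.
  - by move=> y; rewrite mem_addbox => /orP [/eqP -> //|/Qk].
  - move=> i j; rewrite size_row_addbox !ent_addbox.
    case: eqP => [->|ne] /= ji; last by apply: Qr.
    case: (eqVneq j _) => [jm|jm]; first lia.
    case: (eqVneq j.+1 _) => [jm'|jm']; last by apply: Qr; lia.
    have jr : j < size (nth [::] (EG_pair s).2 (new_row s a)) by lia.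
    apply/andP; split; first by apply/mQ/ent_flatten.
    apply/implyP => /eqP ex; rewrite ex; apply/negP => x2.
    have := K (new_row s a); rewrite x2 ltnn => /(_ _)/negP; apply=> //.
    by rewrite -ex mem_nth.
  - have {p'} /is_partitionP [_ p'] : is_partition (shape (addbox (EG_pair s).2 (new_row s a) x)).
      by rewrite shape_addbox -sPQ -s'.
    move=> i j ji; have jj := leq_trans ji (p' i).
    move: ji jj; rewrite !size_row_addbox !ent_addbox.
    case: (eqVneq i (new_row s a)) => [im|im] /=.
      case: (eqVneq i.+1 _) => /=; first lia.
      move=> _ ji _; case: eqP => [jm|_]; last exact: Qc.
      by have := p i; rewrite -im in jm; lia.
    case: (eqVneq i.+1 _) => /= [im'|_ ji _]; last exact: Qc.
    move=> ji jj; case: (eqVneq j _) => jm; last by apply: Qc; rewrite -im' in jm; lia.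
    apply/andP; split; first by apply/mQ/ent_flatten.
    apply/implyP => /eqP ex; rewrite ex; apply/negPn/negP => x2.
    have := K i; rewrite (negbTE x2) -im' ltnn => /(_ _)/negP; apply=> //.
    by rewrite -ex mem_nth.
by move=> q; rewrite count_addbox c map_rcons -cats1 count_cat /=; lia.
Qed.

Lemma new_row_mono k s a b x : EG_inv k s ->
  breduced (map fst (rcons (rcons s (a, x)) (b, x))) ->
  (a < b -> new_row (rcons s (a, x)) b <= new_row s a) /\
  (b < a -> new_row s a < new_row (rcons s (a, x)) b).
Proof.
case=> /tabP [_ tP _] e _ _ _; rewrite !map_rcons -!cats1 => R.
have := breduced_eqv _ _ (beqv_catr [:: b] _ _ (beqv_catr [:: a] _ _ e)) R.
rewrite /= !cats1 => {}R; rewrite /new_row EG_pair_rcons /=.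
case E1: (eg_insert (EG_pair s).1 a) => [P1 m1] /=.
case E2: (eg_insert P1 b) => [P2 m2] /=.
exact: eg_insert2 tP R E1 E2.
Qed.

(** If [y] already occurs, the preceding label, being maximal so far and at most [y], equals [y].
    Then [new_row_mono] compares the two newest boxes, and extremeness of the previous one handles
    the older boxes. *)
Lemma new_row_extreme_rcons k s a b x y : EG_inv k s -> EG_inv k (rcons s (a, x)) ->
  new_row_extreme s a x -> pairwise bilt (rcons (rcons s (a, x)) (b, y)) ->
  all (in_labels k) (rcons (rcons s (a, x)) (b, y)) ->
  breduced (map fst (rcons (rcons s (a, x)) (b, y))) ->
  new_row_extreme (rcons s (a, x)) b y.
Proof.
move=> I I' K; rewrite pairwise_bilt_rcons pairwise_rcons -andbA => /and3P [sx _ xy].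
rewrite !all_rcons => /and3P [ky kx _] R i yi.
have e : y = x.
  have := row_flatten _ _ _ yi; rewrite (EG_inv_mem _ _ _ I') map_rcons mem_rcons inE.
  case/orP=> [/eqP //|/mapP [q /(allP sx)/bilt_prank qx yq]].
  apply: prank_inj; first by case/andP: ky.
    by case/andP: kx.
  apply/eqP; rewrite eqn_leq; apply/andP; split; first by rewrite yq.
  exact: bilt_prank xy.
subst y; move: xy; rewrite /bilt /= ltnn eqxx /=.
have [m1 m2] := new_row_mono _ _ _ _ _ I R.
move: yi; rewrite EG_pair_rcons row_addbox.
have := K i; case: ifP => x2; case: (eqVneq i (new_row s a)) => [->|im] h.
- by move=> _ /m2.
- by move=> /h im' /m2; lia.
- by move=> _ /m1.
- by move=> /h im' /m1; lia.
Qed.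

(** The claims are proved together: preserving the invariant needs extremeness of the next box,
    which in turn uses the invariant of the longer word. *)
Lemma EG_pair_inv k s : pairwise bilt s -> all (in_labels k) s -> breduced (map fst s) ->
  EG_inv k s /\ forall a x, pairwise bilt (rcons s (a, x)) ->
    all (in_labels k) (rcons s (a, x)) -> breduced (map fst (rcons s (a, x))) ->
    new_row_extreme s a x.
Proof.
elim/last_ind: s => [|s [a x] IH].
  move=> _ _ _; split=> [|a x _ _ _ i]; last by rewrite nth_nil.
  split=> //; first exact: beqv_refl.
  by apply/primedP; split=> // i j; rewrite !nth_nil.
move=> B L R; have := B; rewrite pairwise_rcons => /andP [sx Bs].
have := L; rewrite all_rcons => /andP [kx Ls].
have Rs : breduced (map fst s) by move: R; rewrite map_rcons -cats1 => /breduced_catl.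
have [I K] := IH Bs Ls Rs; have K1 := K _ _ B L R.
have I' : EG_inv k (rcons s (a, x)).
  by apply: EG_inv_rcons => //; apply: sub_all sx => q /bilt_prank.
by split=> // b y; apply: new_row_extreme_rcons I I' K1.
Qed.

Lemma new_rowP k s a x : pairwise bilt (rcons s (a, x)) ->
  all (in_labels k) (rcons s (a, x)) -> breduced (map fst (rcons s (a, x))) ->
  [/\ EG_inv k s, EG_inv k (rcons s (a, x)) & new_row_extreme s a x].
Proof.
move=> B L R; have [I' _] := EG_pair_inv _ _ B L R.
have [] := EG_pair_inv k s.
- by move: B; rewrite pairwise_rcons => /andP [].
- by move: L; rewrite all_rcons => /andP [].
- by move: R; rewrite map_rcons -cats1 => /breduced_catl.
by move=> I K; split=> //; apply: K.
Qed.

(** * Injectivity on labelled words *)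

Lemma max_label_le k s t a b x y : EG_inv k (rcons t (b, y)) ->
  (EG_pair (rcons s (a, x))).2 = (EG_pair (rcons t (b, y))).2 ->
  pairwise bilt (rcons t (b, y)) -> prank x <= prank y.
Proof.
move=> I e; rewrite pairwise_rcons => /andP [ty _].
have : x \in flatten (EG_pair (rcons t (b, y))).2.
  by rewrite -e EG_pair_rcons mem_addbox eqxx.
rewrite (EG_inv_mem _ _ _ I) map_rcons mem_rcons inE => /orP [/eqP -> //|].
by case/mapP => q /(allP ty)/bilt_prank h ->.
Qed.

(** The last box of one word carries [x] in the common recording tableau, so it is bounded by the
    extreme box of the other; used in both directions, this makes the rows equal. *)
Lemma new_row_le s t a b x : 
  (EG_pair (rcons s (a, x))).2 = (EG_pair (rcons t (b, x))).2 ->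
  new_row_extreme t b x -> 
  if x.2 then new_row s a <= new_row t b else new_row t b <= new_row s a.
Proof.
rewrite !EG_pair_rcons /= => e K.
have : x \in nth [::] (addbox (EG_pair t).2 (new_row t b) x) (new_row s a).
  by rewrite -e row_addbox eqxx mem_rcons mem_head.
rewrite row_addbox; case: eqP => [-> _|_ /K]; first by rewrite leqnn if_same.
by case: ifP => // _ /ltnW.
Qed.

Lemma EG_pair_inj k s t :
  pairwise bilt s -> all (in_labels k) s -> breduced (map fst s) ->
  pairwise bilt t -> all (in_labels k) t -> breduced (map fst t) ->
  EG_pair s = EG_pair t -> s = t.
Proof.
elim/last_ind: s t => [|s [a x] IH] t Bs Ls Rs Bt Lt Rt e.
  have [[_ _ _ _ c] _] := EG_pair_inv _ _ Bt Lt Rt.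
  by have := c predT; rewrite -e /= !count_predT size_map; case: (t).
case/lastP: t Bt Lt Rt e => [|t [b y]] Bt Lt Rt e.
  have [[_ _ _ _ c] _] := EG_pair_inv _ _ Bs Ls Rs.
  by have := c predT; rewrite e /= !count_predT size_map size_rcons.
have [Is Is' Ks] := new_rowP _ _ _ _ Bs Ls Rs.
have [It It' Kt] := new_rowP _ _ _ _ Bt Lt Rt.
have eQ := congr1 snd e; have eQ' := esym eQ.
have exy : x = y.
  apply: prank_inj.
  - by move: Ls; rewrite all_rcons => /andP [/andP []].
  - by move: Lt; rewrite all_rcons => /andP [/andP []].
  - apply/eqP; rewrite eqn_leq (max_label_le _ _ _ _ _ _ _ It' eQ Bt).
    exact: max_label_le Is' eQ' Bs.
subst y; have := new_row_le _ _ _ _ _ eQ Kt; have := new_row_le _ _ _ _ _ eQ' Ks.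
move=> m1 m2; have {m1 m2} em : new_row s a = new_row t b.
  by apply/eqP; rewrite eqn_leq; case: ifP m1 m2 => _ -> ->.
case: (Is) => tPs es shs _ _; case: (It) => tPt et sht _ _.
have Rs' : breduced (rcons (reading_word (EG_pair s).1) a).
  apply: breduced_eqv Rs; rewrite map_rcons -!cats1; exact: beqv_catr.
have Rt' : breduced (rcons (reading_word (EG_pair t).1) b).
  apply: breduced_eqv Rt; rewrite map_rcons -!cats1; exact: beqv_catr.
move: e; rewrite !EG_pair_rcons em => -[eP {}eQ].
move: em; rewrite /new_row.
case Es: (eg_insert (EG_pair s).1 a) eP => [P1 m1] /= eP.
case Et: (eg_insert (EG_pair t).1 b) eP eQ => [P2 m2] /= eP eQ em.
subst P2 m2; have [ePP eab] := eg_insert_inj _ _ _ _ _ _ tPs tPt Rs' Rt' Es Et.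
subst b; suff -> : s = t by [].
apply: IH.
- by move: Bs; rewrite pairwise_rcons => /andP [].
- by move: Ls; rewrite all_rcons => /andP [].
- by move: Rs; rewrite map_rcons -cats1 => /breduced_catl.
- by move: Bt; rewrite pairwise_rcons => /andP [].
- by move: Lt; rewrite all_rcons => /andP [].
- by move: Rt; rewrite map_rcons -cats1 => /breduced_catl.
rewrite [EG_pair s]surjective_pairing [EG_pair t]surjective_pairing ePP.
congr (_, _); have shQ : shape (EG_pair s).2 = shape (EG_pair t).2.
  by rewrite -shs -sht ePP.
(* The earlier recording tableaux have equal shapes and become equal after adding the same box, so
   they agree off that box. *)
apply: eq_filling => // i j ji.
have := congr1 (fun Q => ent Q i j) eQ; rewrite /= !ent_addbox.
rewrite -!nth_shapeE -shQ !nth_shapeE; case: andP => // -[/eqP im /eqP jm].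
by move: ji; rewrite im jm ltnn.
Qed.

(** * Surjectivity: stripping off the largest label *)

Lemma ex_max_prank (s : seq plet) : s != [::] ->
  exists2 x, x \in s & forall y, y \in s -> prank y <= prank x.
Proof.
elim: s => // z [|z' s] IH _.
  by exists z => [|y]; rewrite inE // => /eqP ->.
have [x xs h] := IH isT; case: (leqP (prank z) (prank x)) => zx.
  by exists x => [|y]; rewrite inE ?xs ?orbT // => /orP [/eqP ->|/h].
exists z => [|y]; first exact: mem_head.
by rewrite inE => /orP [/eqP -> //|/h yx]; apply: leq_trans yx (ltnW zx).
Qed.

Lemma ex_extreme_row (Q : seq (seq plet)) (x : plet) : x \in flatten Q ->
  exists2 m, x \in nth [::] Q m &
    forall i, x \in nth [::] Q i -> if x.2 then i <= m else m <= i.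
Proof.
move/flatten_row => ex; case: x.2.
  have ub i : x \in nth [::] Q i -> i <= size Q.
    by case: (leqP i (size Q)) => // /ltnW /(nth_default [::]) ->.
  by have [m xm h] := ex_maxnP ex ub; exists m.
by have [m xm h] := ex_minnP ex; exists m.
Qed.

Lemma row_prank_mono k Q i j l : primed_tableau k Q -> j <= l -> l < size (nth [::] Q i) ->
  prank (ent Q i j) <= prank (ent Q i l).
Proof.
case/primedP=> _ _ h _; elim: l => [|l IH]; first by rewrite leqn0 => /eqP ->.
rewrite leq_eqVlt => /orP [/eqP -> //|jl] li.
apply: leq_trans (IH jl (ltnW li)) _.
by case/andP: (h i l li).
Qed.

Lemma ent_mem (Q : seq (seq plet)) i j : j < size (nth [::] Q i) -> ent Q i j \in nth [::] Q i.
Proof. exact: mem_nth. Qed.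

(** Take [x] of maximal rank and [m] the lowest (primed) or highest (unprimed) row containing it.
    Row [m] ends in [x]; a box under that end would also carry [x], which forces [x] to be primed
    and contradicts the choice of the lowest row. *)
Lemma primed_corner k Q : primed_tableau k Q -> Q != [::] ->
  exists x m, [/\ 1 <= x.1 <= k, forall y, y \in flatten Q -> prank y <= prank x,
    size (nth [::] Q m.+1) < size (nth [::] Q m),
    ent Q m (size (nth [::] Q m)).-1 = x &
    forall i, x \in nth [::] Q i -> if x.2 then i <= m else m <= i].
Proof.
move=> pQ Q0; have /primedP [/is_partitionP [p0 p] Qk Qr Qc] := pQ.
have [x xQ xmax] : exists2 x, x \in flatten Q & forall y, y \in flatten Q -> prank y <= prank x.
  apply: ex_max_prank; case: (Q) Q0 p0 => // r Q' _ /(_ 0 isT) /=.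
  by case: r.
have [m xm mx] := ex_extreme_row _ _ xQ.
have maxE i j : j < size (nth [::] Q i) -> prank x <= prank (ent Q i j) -> ent Q i j = x.
  move=> ji le; have eQ := ent_flatten _ _ _ ji; apply: prank_inj.
  - by case/andP: (Qk _ eQ).
  - by case/andP: (Qk _ xQ).
  - by apply/eqP; rewrite eqn_leq le xmax.
have xe : ent Q m (size (nth [::] Q m)).-1 = x.
  have [j jm xj] : exists2 j, j < size (nth [::] Q m) & ent Q m j = x.
    by case/(nthP (0, false)): xm => j; exists j.
  apply: maxE; first by lia.
  by rewrite -[in X in X <= _]xj; apply: row_prank_mono pQ _ _; lia.
have sm : 0 < size (nth [::] Q m) by case: (nth _ Q m) xm.
exists x, m; split=> //; first exact: Qk.
rewrite ltnNge; apply/negP => le.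
have lt : (size (nth [::] Q m)).-1 < size (nth [::] Q m.+1) by lia.
have := Qc m _ lt; rewrite /col_ok /ple xe => /andP [le' x2].
have e := maxE _ _ lt le'; move: x2; rewrite e eqxx /= => x2.
have := mx m.+1; rewrite -{1}e ent_mem // x2 => /(_ isT).
by rewrite ltnn.
Qed.

Lemma primed_remove k Q m x : is_partition (shape Q) -> primed_tableau k (addbox Q m x) ->
  primed_tableau k Q.
Proof.
move=> p /primedP [_ Qk Qr Qc]; apply/primedP; split=> //.
- by move=> y yQ; apply: Qk; rewrite mem_addbox yQ orbT.
- move=> i j ji; have := Qr i j; rewrite !ent_addbox size_row_addbox.
  case: (eqVneq i m) => [im|_] /=; last by apply.
  by rewrite -im !ltn_eqF ?(ltnW ji) //; apply; lia.
- move=> i j ji; have := Qc i j; rewrite !ent_addbox size_row_addbox.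
  case/is_partitionP: p => _ /(_ i) p.
  case: (eqVneq i m) => [im|_] /=.
    by rewrite -im (gtn_eqF (ltnSn i)) /= ltn_eqF ?(leq_trans ji p) //; apply; lia.
  case: (eqVneq i.+1 m) => [im|_] /=; last by apply; lia.
  by rewrite -im !ltn_eqF //; apply; lia.
Qed.

Lemma addbox_surj Q m x sh : shape Q = incr_nth sh m ->
  ent Q m (size (nth [::] Q m)).-1 = x ->
  exists2 Q', shape Q' = sh & addbox Q' m x = Q.
Proof.
move=> shQ xe.
(* [Q] cut down to the shape [sh]. *)
pose Q' := [seq [seq ent Q i j | j <- iota 0 (nth 0 sh i)] | i <- iota 0 (size sh)].
have sQ' : shape Q' = sh.
  apply: (@eq_from_nth _ 0); rewrite /shape /Q' -map_comp ?size_map ?size_iota // => i ish.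
  by rewrite (nth_map 0) ?size_iota //= size_map size_iota nth_iota.
exists Q' => //; apply: eq_filling; first by rewrite shape_addbox sQ' shQ.
have sz i : size (nth [::] Q i) = (i == m) + size (nth [::] Q' i).
  by rewrite -!nth_shapeE shQ sQ' nth_incr_nth eq_sym.
move=> i j; rewrite size_row_addbox ent_addbox.
case: ifP => [/andP [/eqP -> /eqP ->] _|/negbT ne ji].
  by rewrite -xe sz eqxx.
have {ne}ji : j < size (nth [::] Q' i).
  case: (eqVneq i m) ne ji => [->|_] /=; last by [].
  by move=> ne; rewrite add1n ltnS leq_eqVlt (negbTE ne).
have ish : i < size sh.
  rewrite -sQ' size_map ltnNge; apply: contraTN ji => /(nth_default [::]) ->.
  by [].
have js : j < nth 0 sh i by rewrite -sQ' nth_shapeE.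
by rewrite (nth_map 0) ?size_iota // (nth_map 0) ?size_iota ?nth_iota.
Qed.

(** For equal labels the order of the last two letters is read back from the rows of their boxes:
    the letters differ by reducedness, and [new_row_mono] rules out the order incompatible with [m]
    being extreme. *)
Lemma bilt_rcons_corner k s b a x m : EG_inv k s ->
  breduced (map fst (rcons (rcons s (b, x)) (a, x))) -> new_row_extreme s b x ->
  new_row (rcons s (b, x)) a = m ->
  primed_tableau k (addbox (EG_pair (rcons s (b, x))).2 m x) ->
  (forall i, x \in nth [::] (addbox (EG_pair (rcons s (b, x))).2 m x) i ->
     if x.2 then i <= m else m <= i) -> bilt (b, x) (a, x).
Proof.
move=> I R K em pQ mx; rewrite /bilt /= ltnn eqxx /=.
have [lt_ba gt_ba] := new_row_mono _ _ _ _ _ I R.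
have ab : a != b.
  apply/negP => /eqP e; apply: (R (map fst s) b [::]).
  by rewrite !map_rcons e -!cats1 -catA; apply: beqv_refl.
set Q' := (EG_pair (rcons s (b, x))).2 in pQ mx.
set m' := new_row s b in lt_ba gt_ba.
have xm' : x \in nth [::] Q' m'.
  by rewrite /Q' EG_pair_rcons row_addbox eqxx mem_rcons mem_head.
have := mx m'; rewrite row_addbox; case: (eqVneq m' m) => [e|ne]; last first.
  rewrite xm' => /(_ isT); case: ifP => _ le.
    by case: (ltngtP a b) ab => // h; have := lt_ba h; lia.
  by case: (ltngtP a b) ab => // h; have := gt_ba h; lia.
move=> _; case: ifP => x2; last by case: (ltngtP a b) ab => // h; have := gt_ba h; lia.
(* Two boxes in the same row with a primed [x] would be adjacent and equal, which [row_ok]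
   forbids. *)
exfalso; have s0 : 0 < size (nth [::] Q' m') by case: (nth _ Q' m') xm'.
have /primedP [_ _ /(_ m (size (nth [::] Q' m)).-1) Qr _] := pQ.
move: Qr; rewrite size_row_addbox !ent_addbox eqxx /= -e prednK //.
rewrite eqxx ltn_eqF ?ltn_predL //.
have -> : ent Q' m' (size (nth [::] Q' m')).-1 = x.
  by rewrite /Q' EG_pair_rcons size_row_addbox ent_addbox eqxx add1n /= eqxx.
by rewrite /row_ok eqxx x2 /= andbF => /(_ (ltnSn _)).
Qed.

(** Induction on the number of boxes: the insertion ending at the corner from [primed_corner] is
    undone, and the released letter with its label is appended to the word of the smaller pair. *)
Lemma EG_pair_surj k P Q : tab P -> breduced (reading_word P) ->
  shape P = shape Q -> primed_tableau k Q ->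
  exists s, [/\ pairwise bilt s, all (in_labels k) s, EG_pair s = (P, Q)
    & beqv (map fst s) (reading_word P)].
Proof.
elim: {Q}(size (flatten Q)) {-2}Q (erefl (size (flatten Q))) P => [|N IH] Q sQ P tP R shPQ pQ.
  suff Q0 : Q = [::].
    exists [::]; move: shPQ; rewrite Q0; case: (P) => // _; split=> //.
    exact: beqv_refl.
  have /primedP [/is_partitionP [p0 _] _ _ _] := pQ.
  by case: (Q) sQ p0 => // r Q' /= + /(_ 0 isT); case: r.
have Q0 : Q != [::] by case: (Q) sQ.
have [x [m [kx xmax corner xe mx]]] := primed_corner _ _ pQ Q0.
have [|P' [a [tP' E e _]]] := eg_insert_surj P m tP R.
  by rewrite shPQ !nth_shapeE.
have R' := breduced_eqv _ _ (beqv_sym _ _ e) R.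
have [_ _ shP _] := eg_insert_spec _ _ _ _ tP' R' E.
have [Q' shQ' eQ] := addbox_surj Q m x (shape P') (etrans (esym shPQ) shP) xe.
have pQ' : primed_tableau k Q'.
  apply: (primed_remove _ _ m x); last by rewrite eQ.
  by rewrite shQ'; case/tabP: tP'.
have sQ' : size (flatten Q') = N.
  by move: sQ; rewrite -eQ -!count_predT count_addbox => -[].
have R1 : breduced (reading_word P') by move: R'; rewrite -cats1 => /breduced_catl.
have [s [Bs Ls Es es]] := IH Q' sQ' P' tP' R1 (esym shQ') pQ'.
have em : new_row s a = m by rewrite /new_row Es /= E.
have e1 : beqv (map fst (rcons s (a, x))) (reading_word P).
  by apply: beqv_trans e; rewrite map_rcons -!cats1; apply: beqv_catr.
have Ra := breduced_eqv _ _ (beqv_sym _ _ e1) R.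
exists (rcons s (a, x)); split=> //; first last.
- by rewrite EG_pair_rcons em Es /= E eQ.
- by rewrite all_rcons Ls andbT.
(* By transitivity of [bilt], only the last letter of [s] has to be compared with the new one. *)
case/lastP: s Bs Ls Es es em e1 Ra => [//|s [b y]] Bs Ls Es es em e1 Ra.
rewrite pairwise_bilt_rcons Bs /=.
have Rs : breduced (map fst (rcons s (b, y))).
  by move: Ra; rewrite map_rcons -cats1 => /breduced_catl.
have [I I' K] := new_rowP _ _ _ _ Bs Ls Rs.
have yQ' : y \in flatten Q' by have := EG_inv_mem _ _ y I'; rewrite Es /= map_rcons mem_rcons mem_head.
have yx : prank y <= prank x by apply: xmax; rewrite -eQ mem_addbox yQ' orbT.
case: (ltngtP (prank y) (prank x)) yx => // [h _|eyx _]; first by rewrite /bilt /= h.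
have {eyx}eyx : y = x.
  apply: prank_inj eyx; last by case/andP: kx.
  by move: Ls; rewrite all_rcons => /andP [/andP []].
subst y; apply: bilt_rcons_corner I Ra K em _ _; rewrite Es /= eQ //.
Qed.

(** * Reduced words of signed permutations *)

Definition adj_tperm n j : {perm 'I_n.+1} := tperm (inord j.-1) (inord j).

Lemma lift_pt_inj n (q : {perm 'I_n.+1}) : injective (fun x : pt n => (x.1, q x.2)).
Proof. by move=> [b i] [c j] /= [-> /perm_inj ->]. Qed.

(** Embeds the symmetric group as the sign-preserving elements that act alike on both signs. *)
Definition lift_pt n (q : {perm 'I_n.+1}) : {perm pt n} := perm (lift_pt_inj n q).

Lemma lift_pt1 n : lift_pt n 1%g = 1%g.
Proof. by apply/permP => -[b i]; rewrite !permE /= ?permE. Qed.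

Lemma lift_ptM n q1 q2 : lift_pt n (q1 * q2)%g = (lift_pt n q1 * lift_pt n q2)%g.
Proof. by apply/permP => x; rewrite permM !permE. Qed.

Lemma gen_lift n a : absz a != 0 -> gen n a = lift_pt n (adj_tperm n (absz a)).
Proof.
move=> a0; rewrite /gen (negbTE a0); apply/permP => -[b i].
rewrite permM !permE /=; set u := inord _.-1; set w := inord _.
by case: b; rewrite !xpair_eqE /=; case: (i == u); rewrite ?xpair_eqE /=; case: (i == w); rewrite ?xpair_eqE.
Qed.

Lemma gen_sqr n a : (gen n a * gen n a = 1)%g.
Proof.
case: (eqVneq (absz a) 0) => a0; first by rewrite /gen a0 tperm2.
by rewrite gen_lift // -lift_ptM tperm2 lift_pt1.
Qed.

Lemma inord_eq n i j : i <= n -> j <= n -> (inord i == inord j :> 'I_n.+1) = (i == j).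
Proof. by move=> ni nj; rewrite -val_eqE /= !inordK. Qed.

Lemma adj_tperm_comm n a b : 0 < a -> a.+1 < b -> b <= n ->
  (adj_tperm n a * adj_tperm n b = adj_tperm n b * adj_tperm n a)%g.
Proof.
move=> a0 ab bn; rewrite conjgC; congr (_ * _)%g.
by rewrite /adj_tperm tpermJ !tpermD // inord_eq; lia.
Qed.

Lemma adj_tperm_braid n a : 0 < a -> a < n ->
  (adj_tperm n a * (adj_tperm n a.+1 * adj_tperm n a) =
   adj_tperm n a.+1 * (adj_tperm n a * adj_tperm n a.+1))%g.
Proof.
move=> a0 an; have conjE b c : (adj_tperm n b * (adj_tperm n c * adj_tperm n b))%g =
    (adj_tperm n c ^ adj_tperm n b)%g by rewrite conjgE tpermV.
rewrite !conjE /adj_tperm !tpermJ /= tpermR tpermL.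
by rewrite !tpermD // inord_eq; lia.
Qed.

Definition letters n (w : seq nat) := all (fun x => 1 <= x <= n) w.

Definition wevaln n (w : seq nat) := weval n [seq Posz x | x <- w].

Lemma wevaln_cat n u v : wevaln n (u ++ v) = (wevaln n u * wevaln n v)%g.
Proof. by rewrite /wevaln /weval map_cat big_cat. Qed.

(** Invariance of [letters] is proved simultaneously, so that the letter bounds carry over to the
    intermediate word of a transitivity step. *)
Lemma beqv_wevaln n w1 w2 : beqv w1 w2 ->
  [/\ size w1 = size w2, letters n w1 = letters n w2
    & letters n w1 -> wevaln n w1 = wevaln n w2].
Proof.
elim=> {w1 w2} [w|w1 w2 _ [s l h]|w1 w2 w3 _ [s l h] _ [s' l' h']|u v w1 w2 _ [s l h]|a b ab|a].
- by [].
- by split=> // l2; apply/esym/h; rewrite l.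
- by split=> [||l1]; [rewrite s|rewrite l|rewrite h // h' // -l].
- rewrite /letters !size_cat s !all_cat -/(letters n w1) -/(letters n w2) -l.
  split=> // /and3P [_ /h e _]; by rewrite !wevaln_cat e.
- rewrite /letters /= !andbT andbC; split=> // /and3P [bn a0 an].
  rewrite /wevaln /weval /= !big_cons !big_nil !mulg1 !gen_lift -?lift_ptM /=; try lia.
  by rewrite adj_tperm_comm //; lia.
- rewrite /letters /=; split=> //; first lia.
  move=> h; rewrite /wevaln /weval /= !big_cons !big_nil !mulg1.
  rewrite !gen_lift -?lift_ptM /=; try lia.
  by rewrite adj_tperm_braid //; lia.
Qed.

Lemma beqv_reduced n omega w1 w2 : beqv w1 w2 -> letters n w1 ->
  reduced_word n omega [seq Posz x | x <- w1] ->
  reduced_word n omega [seq Posz x | x <- w2].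
Proof.
move=> /(beqv_wevaln n) [s l h] l1 [_ e m]; have := l1; rewrite l => l2.
split; first by rewrite /in_gens all_map; apply: sub_all l2 => x /andP [].
  by rewrite -e; apply/esym/h.
by move=> w' g' e'; rewrite size_map -s -(size_map Posz); apply: m.
Qed.

(** Generators are involutions, so a repeated adjacent letter in an equivalent word cancels and
    leaves a shorter word for [omega]. *)
Lemma reduced_breduced n omega w : letters n w ->
  reduced_word n omega [seq Posz x | x <- w] -> breduced w.
Proof.
move=> l [_ e m] u x v /(beqv_wevaln n) [s l' h].
have := l; rewrite l' => l2.
have := m [seq Posz x | x <- u ++ v]; rewrite !size_map s !size_cat /= => H.
suff : size u + (size v).+2 <= size u + size v by lia.
apply: H.
  move: l2; rewrite /in_gens all_map /letters !all_cat /= => /and4P [lu _ _ lv].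
  by apply/andP; split; [apply: sub_all lu|apply: sub_all lv] => z /andP [].
rewrite -e; apply/esym; rewrite -[LHS]/(wevaln n w) h // -[RHS]/(wevaln n (u ++ v)).
rewrite -cat1s -[x :: v]cat1s !wevaln_cat {2 3}/wevaln /weval /= !big_seq1.
by rewrite [(gen n x * (_ * _))%g]mulgA gen_sqr mul1g.
Qed.

(** * Absence of the letter 0 *)

Definition unsigned_perm n (w : seq int) : {perm 'I_n.+1} :=
  (\prod_(a <- w | absz a != 0%N) adj_tperm n (absz a))%g.

Lemma weval_snd n w x : (weval n w x).2 = unsigned_perm n w x.2.
Proof.
rewrite /weval /unsigned_perm; elim: w x => [|a w IH] x; first by rewrite !big_nil !perm1.
rewrite !big_cons permM IH; case: ifP => [a0|/negbFE a0].
  by rewrite permM gen_lift // permE.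
congr (_ _); rewrite /gen a0 permE /=; case: x => b i.
by case: eqP => [[_ ->]|_] //=; case: eqP => [[_ ->]|_].
Qed.

Lemma weval_nonzero n w :
  weval n [seq a <- w | absz a != 0] = lift_pt n (unsigned_perm n w).
Proof.
rewrite /weval /unsigned_perm big_filter; elim: w => [|a w IH].
  by rewrite !big_nil lift_pt1.
by rewrite !big_cons IH; case: ifP => // a0; rewrite lift_ptM gen_lift.
Qed.

Lemma A_sub_lift n omega : omega \in A_sub n -> exists q, omega = lift_pt n q.
Proof.
suff : A_sub n \subset [set lift_pt n q | q in [set: {perm 'I_n.+1}]].
  by move=> /subsetP h /h /imsetP [q _ ->]; exists q.
have gS : group_set [set lift_pt n q | q in [set: {perm 'I_n.+1}]].
  apply/group_setP; split; first by apply/imsetP; exists 1%g; rewrite ?lift_pt1.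
  move=> _ _ /imsetP [q _ ->] /imsetP [q' _ ->].
  by apply/imsetP; exists (q * q')%g; rewrite ?lift_ptM.
rewrite -(gen_set_id gS); apply: genS; apply/subsetP => _ /imsetP [i i0 ->].
apply/imsetP; exists (adj_tperm n i) => //; apply: gen_lift.
by move: i0; rewrite inE -lt0n.
Qed.

(** An element of [A_sub] is determined by its action on positions, where the letter 0 acts
    trivially. So the word without zeros still evaluates to [omega], and minimality leaves no zero
    to delete. *)
Lemma reduced_nonzero n omega w : omega \in A_sub n -> reduced_word n omega w ->
  all (fun a : int => absz a != 0) w.
Proof.
move=> /A_sub_lift [q eq] [g e m].
have eqq : q = unsigned_perm n w.
  apply/permP => i; have := weval_snd n w (true, i).
  by rewrite e eq permE.
have := m [seq a <- w | absz a != 0]; rewrite weval_nonzero -eqq -eq => /(_ _ erefl) H.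
rewrite all_count eqn_leq count_size -size_filter; apply: H.
by apply/allP => a; rewrite mem_filter => /andP [_]; apply: (allP g).
Qed.

Lemma reduced_abs n omega w :
  reduced_word n omega [seq Posz x | x <- map absz w] <-> reduced_word n omega w.
Proof.
have e : weval n [seq Posz x | x <- map absz w] = weval n w by rewrite /weval !big_map.
rewrite /reduced_word e /in_gens !all_map !size_map; split=> -[h1 h2 h3]; split=> //.
Qed.

(** * Signed increasing factorizations as labelled words *)

Definition signed_letter l (a : int) : biletter := (absz a, (l, (a < 0)%R)).

Definition unsigned_letter (p : biletter) : int :=
  if p.2.2 then (- Posz p.1)%R else Posz p.1.

(** [i] counts the blocks already read, so that the next one gets label [i.+1]. *)
Fixpoint biword i (v : seq (seq int)) : seq biletter :=
  if v is B :: v' then map (signed_letter i.+1) B ++ biword i.+1 v' else [::].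

Lemma signed_letterK l : cancel (signed_letter l) unsigned_letter.
Proof. by move=> a; rewrite /signed_letter /unsigned_letter /=; case: ifP; lia. Qed.

Lemma biword_fst i v : map fst (biword i v) = abs_word v.
Proof.
rewrite /abs_word; elim: v i => //= B v IH i.
by rewrite !map_cat IH -map_comp.
Qed.

Lemma biword_snd i v : map snd (biword i v) =
  flatten [seq [seq ((i + j).+1, (a < 0)%R) | a <- nth [::] v j] | j <- iota 0 (size v)].
Proof.
elim: v i => //= B v IH i; rewrite map_cat IH -map_comp addn0; congr (_ ++ flatten _).
rewrite -[1]addn0 iotaDl -map_comp; apply: eq_map => j /=.
by rewrite addSnnS.
Qed.

Lemma EG_PQ_biword v : EG_PQ v = EG_pair (biword 0 v).
Proof.
rewrite /EG_PQ /EG_pair -(biword_fst 0); congr foldl.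
by rewrite -[RHS]zip_unzip; congr zip; rewrite /unzip2 biword_snd.
Qed.

Lemma biword_labels i v : all (fun p : biletter => i < p.2.1 <= i + size v) (biword i v).
Proof.
elim: v i => //= B v IH i; rewrite all_cat all_map; apply/andP; split.
  by apply/allP => a _ /=; lia.
by apply: sub_all (IH i.+1) => p /=; lia.
Qed.

Lemma bilt_signed_letter l (a b : int) : absz a != 0 -> absz b != 0 ->
  bilt (signed_letter l.+1 a) (signed_letter l.+1 b) = (a < b)%R.
Proof.
rewrite /bilt /prank /= xpair_eqE eqxx /=.
by case: (ltrP a 0); case: (ltrP b 0) => /=; lia.
Qed.

Lemma pairwise_biword i v : all (all (fun a : int => absz a != 0)) v ->
  all (sorted (fun a b : int => a < b)%R) v -> pairwise bilt (biword i v).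
Proof.
elim: v i => //= B v IH i /andP [nB nv] /andP [sB sv].
rewrite pairwise_cat IH // andbT; apply/andP; split.
  apply/allrelP => p q /mapP [a _ ->] /(allP (biword_labels _ _)) /andP [h _].
  by apply/orP; left; rewrite /prank /=; move: h; lia.
rewrite pairwise_map.
move: sB; rewrite (sorted_pairwise lt_trans).
elim: B nB => //= a B IHB /andP [na nB] /andP [aB sB].
rewrite IHB // andbT; apply/allP => b bB.
suff : bilt (signed_letter i.+1 a) (signed_letter i.+1 b) by [].
by rewrite bilt_signed_letter ?na ?(allP nB _ bB) //; have := allP aB _ bB.
Qed.

Lemma biword_filter i B v :
  [seq p <- biword i (B :: v) | p.2.1 == i.+1] = map (signed_letter i.+1) B /\
  [seq p <- biword i (B :: v) | p.2.1 != i.+1] = biword i.+1 v.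
Proof.
have h := allP (biword_labels i.+1 v); rewrite /= !filter_cat; split.
  rewrite (@eq_in_filter _ _ xpredT) ?filter_predT; last first.
    by move=> _ /mapP [a _ ->]; rewrite /= eqxx.
  rewrite (@eq_in_filter _ _ pred0 (biword i.+1 v)) ?filter_pred0 ?cats0 //.
  by move=> -[a [l b]] /h /=; lia.
rewrite (@eq_in_filter _ _ pred0) ?filter_pred0; last first.
  by move=> _ /mapP [a _ ->]; rewrite /= eqxx.
by apply/all_filterP/allP => -[a [l b]] /h /=; lia.
Qed.

(** Labels tell the blocks apart. Empty blocks leave no letter, so trailing ones are detected by the
    sizes. *)
Lemma biword_inj i v1 v2 : size v1 = size v2 -> biword i v1 = biword i v2 -> v1 = v2.
Proof.
elim: v1 v2 i => [|B v1 IH] [|C v2] //= i [s] e.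
have [f1 g1] := biword_filter i B v1; have [f2 g2] := biword_filter i C v2.
move: f1 g1; rewrite /= e => f1 g1; move: f2 g2; rewrite /= f1 g1 => f2 g2.
by rewrite (IH _ _ s g2) (inj_map (can_inj (signed_letterK i.+1)) f2).
Qed.

Lemma label_mono (p q : biletter) : bilt p q -> p.2.1 <= q.2.1.
Proof. by move/bilt_prank; rewrite /prank; case: p.2 q.2 => [a []] [b []] /=; lia. Qed.

(** Block indices weakly increase along a [bilt] word, so the letters with the least possible index
    form a prefix. *)
Lemma bilt_filter_cat l s : pairwise bilt s -> all (fun p : biletter => l <= p.2.1) s ->
  s = [seq p <- s | p.2.1 == l] ++ [seq p <- s | p.2.1 != l].
Proof.
elim: s => //= p s IH /andP [ps s_bilt] /andP [lp ls].
case: eqP => pl /=; first by rewrite -IH.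
have lp' : l < p.2.1 by rewrite ltn_neqAle lp andbT eq_sym; apply/eqP.
have h (q : biletter) : q \in s -> l < q.2.1.
  by move=> /(allP ps)/label_mono; apply: leq_trans.
rewrite (@eq_in_filter _ _ pred0) ?filter_pred0 /=; last by move=> -[a [r b]] /h /=; lia.
by congr cons; apply/esym/all_filterP/allP => -[a [r b]] /h /=; lia.
Qed.

Lemma biword_surj k i s : pairwise bilt s ->
  all (fun p : biletter => (i < p.2.1 <= i + k) && (0 < p.1)) s ->
  exists v, [/\ size v = k, biword i v = s
    & all (sorted (fun a b : int => a < b)%R) v].
Proof.
elim: k i s => [|k IH] i s Bs Ls.
  exists [::]; split=> //; case: s Ls {Bs} => //= p s /andP [h _]; lia.
have Es := bilt_filter_cat i.+1 s Bs (sub_all _ Ls).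
have {Es} -> : s = [seq p <- s | p.2.1 == i.+1] ++ [seq p <- s | p.2.1 != i.+1].
  by apply: Es => p /=; lia.
have [|v [sv ev ov]] := IH i.+1 [seq p <- s | p.2.1 != i.+1] (pairwise_filter _ Bs).
  apply/allP => p; rewrite mem_filter => /andP [].
  by move: (p : biletter) => {p} [a [l b]] /= ne /(allP Ls) /=; lia.
set s1 := [seq p <- s | p.2.1 == i.+1].
have Ls1 (p : biletter) : p \in s1 -> p.2.1 = i.+1 /\ 0 < p.1.
  by rewrite mem_filter => /andP [/eqP -> /(allP Ls) /andP [_ ->]].
(* Letters are positive here; a primed 0 would lose its sign. *)
have us1 : map (signed_letter i.+1) (map unsigned_letter s1) = s1.
  rewrite -map_comp; apply/map_id_in => -[a [l b]] /Ls1 /= [-> a0].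
  by rewrite /signed_letter /unsigned_letter /=; case: b => /=; congr (_, (_, _)); lia.
exists (map unsigned_letter s1 :: v); split=> /=; [by rewrite sv|by rewrite us1 ev|].
rewrite ov andbT (sorted_pairwise lt_trans).
have : pairwise bilt s1 by apply: pairwise_filter.
rewrite -{1}us1 pairwise_map.
have : all (fun a : int => absz a != 0) (map unsigned_letter s1).
  apply/allP => _ /mapP [p /Ls1 [_ p0] ->]; rewrite /unsigned_letter.
  by case: ifP; lia.
elim: (map unsigned_letter s1) => //= a B IHB /andP [na nB] /andP [aB sB].
rewrite IHB // andbT; apply/allP => b bB.
by rewrite -(bilt_signed_letter i) ?na ?(allP nB _ bB) //; have := allP aB _ bB.
Qed.

Lemma biword_weight i v b :
  [seq count (pred1 (j, b)) (map snd (biword i v)) | j <- iota i.+1 (size v)] =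
  [seq count (fun a : int => (a < 0)%R == b) B | B <- v].
Proof.
elim: v i => //= B v IH i; rewrite map_cat count_cat; congr cons.
  rewrite [X in _ + X](_ : _ = 0).
    by rewrite addn0 -map_comp count_map; apply: eq_count => a /=; rewrite xpair_eqE eqxx.
  apply/eqP; rewrite -leqn0 leqNgt -has_count; apply/hasPn => _ /mapP [p /(allP (biword_labels _ _)) h ->].
  by rewrite /= -pair_eqE /pair_eq /=; lia.
rewrite -(IH i.+1); apply/eq_in_map => j; rewrite mem_iota => ji.
rewrite count_cat [X in X + _](_ : _ = 0) //.
apply/eqP; rewrite -leqn0 leqNgt -has_count; apply/hasPn => _ /mapP [_ /mapP [a _ ->] ->].
by rewrite /= xpair_eqE; lia.
Qed.

Lemma RSIF_biword n k omega v : omega \in A_sub n -> RSIF n k omega v ->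
  let s := biword 0 v in
  [/\ pairwise bilt s, all (in_labels k) s, breduced (map fst s),
      letters n (map fst s) & reduced_word n omega [seq Posz x | x <- map fst s]].
Proof.
move=> Ao [<- sv rv]; have nz := reduced_nonzero _ _ _ Ao rv.
rewrite /= biword_fst; have rv' := (reduced_abs _ _ _).2 rv.
have l : letters n (abs_word v).
  rewrite /abs_word /letters all_map; case: rv => g _ _.
  by apply/allP => a av; rewrite /= (allP g) // lt0n (allP nz).
split=> //; first by apply: pairwise_biword => //; rewrite all_all_flatten.
  by apply: sub_all (biword_labels 0 v) => p.
exact: reduced_breduced rv'.
Qed.

(** * The bijection and the double weight *)

Theorem theorem2p1 (n k : nat) (omega : {perm pt n}) :
  (1 <= n)%N -> (1 <= k)%N -> omega \in A_sub n ->
  (* well-defined: lands in the target set *)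
  (forall v, RSIF n k omega v ->
     [/\ EG_tableau n omega (EG_P v), primed_tableau k (EG_Q v)
       & shape (EG_P v) = shape (EG_Q v)]) /\
  (* injective *)
  (forall v1 v2, RSIF n k omega v1 -> RSIF n k omega v2 ->
     EG_PQ v1 = EG_PQ v2 -> v1 = v2) /\
  (* surjective *)
  (forall P Q, EG_tableau n omega P -> primed_tableau k Q -> shape P = shape Q ->
     exists v, RSIF n k omega v /\ EG_PQ v = (P, Q)) /\
  (* preserves double weight *)
  (forall v, RSIF n k omega v ->
     dw_fact1 v = dw_tab1 k (EG_Q v) /\ dw_fact2 v = dw_tab2 k (EG_Q v)).
Proof.
move=> _ _ Ao.
have mem_reading (P : seq (seq nat)) : letters n (reading_word P) =
    all (fun r => all (fun x => 1 <= x <= n) r) P.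
  by rewrite /letters /reading_word -all_all_flatten all_rev.
split=> [v Rv|].
  have [B L R l rw] := RSIF_biword _ _ _ _ Ao Rv.
  have [[/tabP [h1 h2 h3] e sh pQ _] _] := EG_pair_inv _ _ B L R.
  rewrite /EG_P /EG_Q EG_PQ_biword; split=> //; split=> //.
    by rewrite -mem_reading; have [_ <- _] := beqv_wevaln n _ _ e.
  exact: beqv_reduced e l rw.
split=> [v1 v2 R1 R2|].
  have [B1 L1 r1 _ _] := RSIF_biword _ _ _ _ Ao R1.
  have [B2 L2 r2 _ _] := RSIF_biword _ _ _ _ Ao R2.
  rewrite !EG_PQ_biword => e.
  apply: (biword_inj 0); last exact: EG_pair_inj B1 L1 r1 B2 L2 r2 e.
  by case: R1 R2 => -> _ _ [-> _ _].
split=> [P Q [h1 h2 h3 h4 rw] pQ sh|v Rv].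
  have tP : tab P by apply/tabP.
  have lP : letters n (reading_word P) by rewrite mem_reading.
  have R := reduced_breduced _ _ _ lP rw.
  have [s [B L Es e]] := EG_pair_surj _ _ _ tP R sh pQ.
  have ls : letters n (map fst s) by have [_ -> _] := beqv_wevaln n _ _ e.
  have [|v [sv ev ov]] := biword_surj k 0 s B.
    apply/allP => p ps; have kp : 1 <= p.2.1 <= k := allP L _ ps.
    rewrite add0n kp /=.
    by have /andP [] := allP ls _ (map_f fst ps).
  exists v; split; last by rewrite EG_PQ_biword ev.
  (* Signs do not affect the product, so reducedness is checked on absolute values, where the word
     is braid equivalent to the reading word of [P]. *)
  split=> //; apply/reduced_abs; rewrite -[map absz _]/(abs_word v) -(biword_fst 0) ev.
  exact: beqv_reduced (beqv_sym _ _ e) lP rw.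
have [B L R _ _] := RSIF_biword _ _ _ _ Ao Rv.
have [[_ _ _ _ c] _] := EG_pair_inv _ _ B L R.
case: Rv => <- _ _; rewrite /dw_tab1 /dw_tab2 /EG_Q EG_PQ_biword.
have w b : [seq count (pred1 (j, b)) (flatten (EG_pair (biword 0 v)).2)
      | j <- iota 1 (size v)] = [seq count (fun a : int => (a < 0)%R == b) C | C <- v].
  by rewrite -(biword_weight 0); apply: eq_map => j; rewrite c.
rewrite !w; split; apply: eq_map => C; apply: eq_count => a /=; first by rewrite eqb_id.
by rewrite leNgt eqbF_neg.
Qed.
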